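(* (1) The first-order theory of free lattices (the set of first-order sentences in the language $\{\leq\}$ that are true in every free lattice) is undecidable. (2) The first-order theory of finitely generated free lattices (the set of first-order sentences in the language $\{\leq\}$ true in every finitely generated free lattice) is undecidable. (3) For every cardinal $\kappa \geq 3$, the first-order theory of the free lattice $\mathbf F_\kappa$ is undecidable.
   Context: Lattices are regarded as structures in the language $\{\leq\}$ of posets. $\mathbf F_\kappa$ denotes the free lattice on $\kappa$ generators. A theory is undecidable if there is no algorithm deciding membership of a sentence in it. *)

(* Defs.v *)
From Stdlib Require Cantor.
From HB Require Import structures.
From mathcomp Require Import all_boot all_order boolp.
Set Implicit Arguments.
Unset Strict Implicit.
Unset Printing Implicit Defensive.
Import Order.TTheory.
Local Open Scope order_scope.

(* Variables are natural numbers; [Fall x phi] and [Fex x phi] bind [x]. *)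
Inductive formula : Type :=
| Fle of nat & nat
| Feq of nat & nat
| Fneg of formula
| Fand of formula & formula
| For of formula & formula
| Fimp of formula & formula
| Fall of nat & formula
| Fex of nat & formula.

Fixpoint free_vars (phi : formula) : seq nat :=
  match phi with
  | Fle x y | Feq x y => [:: x; y]
  | Fneg p => free_vars p
  | Fand p q | For p q | Fimp p q => free_vars p ++ free_vars q
  | Fall x p | Fex x p => [seq y <- free_vars p | y != x]
  end.

Definition sentence (phi : formula) : Prop := free_vars phi = [::].

Definition update (T : Type) (v : nat -> T) (x : nat) (a : T) : nat -> T :=
  fun y => if y == x then a else v y.

Fixpoint satisfies (d : Order.disp_t) (L : porderType d) (v : nat -> L)
    (phi : formula) : Prop :=
  match phi with
  | Fle x y => v x <= v y
  | Feq x y => v x = v y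
  | Fneg p => ~ satisfies v p
  | Fand p q => satisfies v p /\ satisfies v q
  | For p q => satisfies v p \/ satisfies v q
  | Fimp p q => satisfies v p -> satisfies v q
  | Fall x p => forall a : L, satisfies (update v x a) p
  | Fex x p => exists a : L, satisfies (update v x a) p
  end.

(* The value of a sentence does not depend on the assignment [v]. *)
Definition true_in (d : Order.disp_t) (L : porderType d) (phi : formula) :
    Prop :=
  forall v : nat -> L, satisfies v phi.

Inductive recfun : nat -> Type :=
| Rzero n : recfun n
| Rsucc : recfun 1
| Rproj n : 'I_n -> recfun n
| Rcomp m n : recfun m -> ('I_m -> recfun n) -> recfun n
| Rprec n : recfun n -> recfun n.+2 -> recfun n.+1
| Rmu n : recfun n.+1 -> recfun n.

(* [prec_graph F G k z]: [z] is the value at [k] of the function [r] defined by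
   [r 0 = F] and [r k.+1 = G k (r k)], for partial [F] and [G] given by their
   graphs. *)
Fixpoint prec_graph (F : nat -> Prop) (G : nat -> nat -> nat -> Prop)
    (k z : nat) : Prop :=
  match k with
  | 0 => F z
  | k'.+1 => exists y, prec_graph F G k' y /\ G k' y z
  end.

(* [reval f xs z]: [f] halts on the arguments [xs] with value [z]. *)
Fixpoint reval (n : nat) (f : recfun n) : n.-tuple nat -> nat -> Prop :=
  match f in recfun n return n.-tuple nat -> nat -> Prop with
  | Rzero _ => fun _ z => z = 0
  | Rsucc => fun xs z => z = (thead xs).+1
  | Rproj _ i => fun xs z => z = tnth xs i
  | Rcomp m n f g => fun xs z =>
      exists ys : m.-tuple nat,
        (forall i : 'I_m, reval (g i) xs (tnth ys i)) /\ reval f ys z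
  | Rprec n f g => fun xs z =>
      prec_graph (reval f [tuple of behead xs])
        (fun k y => reval g [tuple of k :: y :: behead xs]) (thead xs) z
  | Rmu n f => fun xs z =>
      reval f [tuple of z :: xs] 0 /\
      (forall k, (k < z)%N -> exists y, reval f [tuple of k :: xs] y.+1)
  end.

Definition pair_code (x y : nat) : nat := Cantor.to_nat (x, y).

Fixpoint godel (phi : formula) : nat :=
  match phi with
  | Fle x y => pair_code 0 (pair_code x y)
  | Feq x y => pair_code 1 (pair_code x y)
  | Fneg p => pair_code 2 (godel p)
  | Fand p q => pair_code 3 (pair_code (godel p) (godel q))
  | For p q => pair_code 4 (pair_code (godel p) (godel q))
  | Fimp p q => pair_code 5 (pair_code (godel p) (godel q))
  | Fall x p => pair_code 6 (pair_code x (godel p))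
  | Fex x p => pair_code 7 (pair_code x (godel p))
  end.

Lemma pair_code_inj (x y x' y' : nat) :
  pair_code x y = pair_code x' y' -> x = x' /\ y = y'.
Proof.
move=> /(congr1 Cantor.of_nat).
by rewrite /pair_code !Cantor.cancel_of_to => -[-> ->].
Qed.

Lemma godel_inj : injective godel.
Proof.
elim=> [x y|x y|p IHp|p IHp q IHq|p IHp q IHq|p IHp q IHq|x p IHp|x p IHp];
  case=> [x' y'|x' y'|p'|p' q'|p' q'|p' q'|x' p'|x' p'] /=;
  move=> /pair_code_inj [] // _.
- by move=> /pair_code_inj [-> ->].
- by move=> /pair_code_inj [-> ->].
- by move=> /IHp ->.
- by move=> /pair_code_inj [/IHp -> /IHq ->].
- by move=> /pair_code_inj [/IHp -> /IHq ->].
- by move=> /pair_code_inj [/IHp -> /IHq ->].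
- by move=> /pair_code_inj [-> /IHp ->].
- by move=> /pair_code_inj [-> /IHp ->].
Qed.

(* The algorithm has to halt on (codes of) sentences only. *)
Definition decidable_theory (Th : formula -> Prop) : Prop :=
  exists f : recfun 1, forall phi : formula, sentence phi ->
    (Th phi -> reval f [tuple godel phi] 1) /\
    (~ Th phi -> reval f [tuple godel phi] 0).

Definition undecidable_theory (Th : formula -> Prop) : Prop :=
  ~ decidable_theory Th.

Definition lattice_hom (d d' : Order.disp_t) (L : latticeType d)
    (M : latticeType d') (h : L -> M) : Prop :=
  Order.meet_morphism h /\ Order.join_morphism h.

Definition free_lattice_on (X : Type) (d : Order.disp_t) (L : latticeType d)
    (i : X -> L) : Prop :=
  forall (d' : Order.disp_t) (M : latticeType d') (g : X -> M),
    exists h : L -> M,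
      [/\ lattice_hom h, (forall x, h (i x) = g x) &
          forall h' : L -> M,
            lattice_hom h' -> (forall x, h' (i x) = g x) -> h' =1 h].

(* A [latticeType] may be empty; structures of first-order logic are not. *)
Definition free_lattice (d : Order.disp_t) (L : latticeType d) : Prop :=
  exists (X : Type) (i : X -> L), inhabited X /\ free_lattice_on i.

Definition finitely_generated (d : Order.disp_t) (L : latticeType d) : Prop :=
  exists s : seq L, forall P : L -> Prop,
    (forall x, x \in s -> P x) ->
    (forall x y, P x -> P y -> P (x `&` y)) ->
    (forall x y, P x -> P y -> P (x `|` y)) ->
    forall x, P x.

Definition Th_lattice (d : Order.disp_t) (L : latticeType d) (phi : formula) :
    Prop :=
  sentence phi /\ true_in L phi.

Definition Th_free_lattices (phi : formula) : Prop :=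
  sentence phi /\
  forall (d : Order.disp_t) (L : latticeType d),
    free_lattice L -> true_in L phi.

Definition Th_fg_free_lattices (phi : formula) : Prop :=
  sentence phi /\
  forall (d : Order.disp_t) (L : latticeType d),
    free_lattice L -> finitely_generated L -> true_in L phi.

Inductive term (X : Type) : Type :=
| Tvar of X
| Tmeet of term X & term X
| Tjoin of term X & term X.

Inductive term_le (X : Type) : term X -> term X -> Prop :=
| term_le_refl s : term_le s s
| term_le_trans s t u : term_le s t -> term_le t u -> term_le s u
| term_le_meetl s t : term_le (Tmeet s t) s
| term_le_meetr s t : term_le (Tmeet s t) t
| term_le_meet s t u : term_le s t -> term_le s u -> term_le s (Tmeet t u)
| term_le_joinl s t : term_le s (Tjoin s t)
| term_le_joinr s t : term_le t (Tjoin s t)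
| term_le_join s t u : term_le s u -> term_le t u -> term_le (Tjoin s t) u.

Record term_class (X : Type) : Type := TermClass {
  class_set : term X -> Prop;
  class_setP : exists s, class_set = (fun t => term_le s t /\ term_le t s) }.

HB.instance Definition _ (X : Type) := gen_eqMixin (term_class X).
HB.instance Definition _ (X : Type) := gen_choiceMixin (term_class X).

Section TermLattice.
Variable X : Type.
Implicit Types (s t u : term X) (a b c : term_class X).

Definition to_class s : term_class X :=
  TermClass (ex_intro _ s (erefl (fun t => term_le s t /\ term_le t s))).

Definition of_class a : term X := projT1 (cid (class_setP a)).

Lemma of_classK a : to_class (of_class a) = a.
Proof.
rewrite /of_class; case: cid => s /= e; case: a e => A p /= e.
rewrite /to_class; move: (ex_intro _ _ _) => q; case: _ / (esym e) p => p.
by congr TermClass; exact: Prop_irrelevance.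
Qed.

Lemma to_classP s t : to_class s = to_class t <-> term_le s t /\ term_le t s.
Proof.
split=> [[/(congr1 (@^~ t)) e]|[st ts]].
  by move: (term_le_refl t) => tt; have [] : term_le s t /\ term_le t s
    by rewrite e.
have e : (fun u => term_le s u /\ term_le u s) =
         (fun u => term_le t u /\ term_le u t).
  apply: funext => u; apply: propext.
  by split=> -[]; split; apply: term_le_trans; eauto.
rewrite /to_class; move: (ex_intro _ s _) (ex_intro _ t _).
case: _ / e => p q; by congr TermClass; exact: Prop_irrelevance.
Qed.

Lemma to_classK s : term_le (of_class (to_class s)) s /\
                    term_le s (of_class (to_class s)).
Proof. by apply/to_classP; exact: of_classK. Qed.

Definition class_le a b : bool := `[< term_le (of_class a) (of_class b) >].

Fact class_le_refl : reflexive class_le.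
Proof. by move=> a; apply/asboolP; exact: term_le_refl. Qed.

Fact class_le_anti : antisymmetric class_le.
Proof.
move=> a b /andP[/asboolP ab /asboolP ba].
by rewrite -(of_classK a) -(of_classK b); apply/to_classP.
Qed.

Fact class_le_trans : transitive class_le.
Proof.
move=> b a c /asboolP ab /asboolP bc; apply/asboolP.
exact: term_le_trans ab bc.
Qed.

HB.instance Definition _ := Order.Le_isPOrder.Build (Order.Disp tt tt)
  (term_class X) class_le_refl class_le_anti class_le_trans.

Lemma to_class_le s t : (to_class s <= to_class t) = `[< term_le s t >].
Proof.
have [s1 s2] := to_classK s; have [t1 t2] := to_classK t.
apply/asboolP/asboolP => st.
  exact: term_le_trans s2 (term_le_trans st t1).
exact: term_le_trans s1 (term_le_trans st t2).
Qed.

Definition class_meet a b := to_class (Tmeet (of_class a) (of_class b)).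
Definition class_join a b := to_class (Tjoin (of_class a) (of_class b)).

Fact class_meetP a b c : (a <= class_meet b c) = (a <= b) && (a <= c).
Proof.
rewrite -(of_classK a) -{2}(of_classK b) -{2}(of_classK c) !to_class_le.
apply/asboolP/andP => [h|[/asboolP ab /asboolP ac]].
  split; apply/asboolP; apply: term_le_trans h _.
    exact: term_le_meetl.
  exact: term_le_meetr.
exact: term_le_meet.
Qed.

Fact class_joinP a b c : (class_join a b <= c) = (a <= c) && (b <= c).
Proof.
rewrite -(of_classK c) -{2}(of_classK a) -{2}(of_classK b) !to_class_le.
apply/asboolP/andP => [h|[/asboolP ac /asboolP bc]].
  split; apply/asboolP; apply: term_le_trans h.
    exact: term_le_joinl.
  exact: term_le_joinr.
exact: term_le_join.
Qed.

HB.instance Definition _ := Order.POrder_MeetJoin_isLattice.Build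
  (Order.Disp tt tt) (term_class X) class_meetP class_joinP.

Lemma to_class_meet s t : to_class (Tmeet s t) = to_class s `&` to_class t.
Proof.
apply/to_classP; have [s1 s2] := to_classK s; have [t1 t2] := to_classK t.
split; apply: term_le_meet.
- exact: term_le_trans (term_le_meetl _ _) s2.
- exact: term_le_trans (term_le_meetr _ _) t2.
- exact: term_le_trans (term_le_meetl _ _) s1.
- exact: term_le_trans (term_le_meetr _ _) t1.
Qed.

Lemma to_class_join s t : to_class (Tjoin s t) = to_class s `|` to_class t.
Proof.
apply/to_classP; have [s1 s2] := to_classK s; have [t1 t2] := to_classK t.
split; apply: term_le_join.
- exact: term_le_trans s2 (term_le_joinl _ _).
- exact: term_le_trans t2 (term_le_joinr _ _).
- exact: term_le_trans s1 (term_le_joinl _ _).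
- exact: term_le_trans t1 (term_le_joinr _ _).
Qed.

Fixpoint term_eval (d : Order.disp_t) (M : latticeType d) (g : X -> M) s : M :=
  match s with
  | Tvar x => g x
  | Tmeet s t => term_eval g s `&` term_eval g t
  | Tjoin s t => term_eval g s `|` term_eval g t
  end.

Lemma term_eval_le (d : Order.disp_t) (M : latticeType d) (g : X -> M) s t :
  term_le s t -> term_eval g s <= term_eval g t.
Proof.
elim=> //= [? ? ? _ + _|? ?|? ?|? ? ? _ h1 _ h2|? ?|? ?|? ? ? _ h1 _ h2].
- exact: le_trans.
- exact: leIl.
- exact: leIr.
- by rewrite lexI h1 h2.
- exact: leUl.
- exact: leUr.
- by rewrite leUx h1 h2.
Qed.

Lemma term_eval_to_class (d : Order.disp_t) (M : latticeType d) (g : X -> M) s :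
  term_eval g (of_class (to_class s)) = term_eval g s.
Proof.
have [h1 h2] := to_classK s.
by apply: le_anti; rewrite !term_eval_le.
Qed.

End TermLattice.

Theorem free_lattice_on_exists (X : Type) :
  exists (d : Order.disp_t) (L : latticeType d) (i : X -> L),
    free_lattice_on i.
Proof.
exists (Order.Disp tt tt), (term_class X), (fun x => to_class (Tvar x)).
move=> d M g; exists (fun a => term_eval g (of_class a)); split.
- by split=> a b /=; rewrite term_eval_to_class.
- by move=> x; rewrite term_eval_to_class.
- move=> h' [hI hU] hx a; rewrite -{1}(of_classK a).
  elim: (of_class a) => [x|s IHs t IHt|s IHs t IHt] /=; first exact: hx.
    by rewrite to_class_meet hI IHs IHt.
  by rewrite to_class_join hU IHs IHt.
Qed.

(* Main.v *)
(* The canonical joinands of an element [w] of a free lattice form a finite set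
   that is definable from [w]; they serve as numbers.  With further parameters
   [c] and [e], an element [r] encodes the set of pairs [(u, u')] of numbers
   with [(u `|` c) `&` (u' `|` e) <= r].  When the relation encoded by one more
   parameter is a strict total order of the numbers, every number has a standard
   value, since there are finitely many of them.  The graph of a recursive
   function can then be described by a first-order formula, in which a primitive
   recursion quantifies over a relation that contains its sequence of values.
   Such a description is sound in every free lattice.  In a free lattice with
   three generators [x], [y], [z] there are a strictly increasing sequence
   [up n >= x] and a strictly decreasing one [down n >= y], and the elements
   [pt n = up n `&` down n] are so independent that, by Whitman's condition,
   arbitrarily long initial segments of the natural numbers and all finite
   relations on them are encoded; so every halting computation is described for
   some value of the parameters.  A decision procedure [f] for the theory is
   refuted by the sentence which says that [f] takes no value but 0 at the code
   of that sentence itself. *)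
Require Import Defs.
From mathcomp Require Import all_boot all_order boolp zify.
Set Implicit Arguments.
Unset Strict Implicit.
Unset Printing Implicit Defensive.
Import Order.TTheory.
Local Open Scope order_scope.

(** * Whitman's condition *)

Section Whitman.
Variable X : Type.
Implicit Types s t u : term X.

(** Whitman's calculus: no transitivity rule, and reflexivity for variables only. Inverting a
    derivation of a meet below a join therefore leaves just the four cases of Whitman's
    condition. *)
Inductive cutfree_le : term X -> term X -> Prop :=
| cutfree_var x : cutfree_le (Tvar x) (Tvar x)
| cutfree_meetl s t u : cutfree_le s u -> cutfree_le (Tmeet s t) u
| cutfree_meetr s t u : cutfree_le t u -> cutfree_le (Tmeet s t) u
| cutfree_meet s t u :
    cutfree_le s t -> cutfree_le s u -> cutfree_le s (Tmeet t u)
| cutfree_joinl s t u : cutfree_le s t -> cutfree_le s (Tjoin t u)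
| cutfree_joinr s t u : cutfree_le s u -> cutfree_le s (Tjoin t u)
| cutfree_join s t u :
    cutfree_le s u -> cutfree_le t u -> cutfree_le (Tjoin s t) u.
Hint Constructors cutfree_le : core.

Lemma cutfree_joinP s t u :
  cutfree_le (Tjoin s t) u -> cutfree_le s u /\ cutfree_le t u.
Proof.
move e : (Tjoin s t) => a au; elim: au e => //.
- by move=> ? ? ? _ h1 _ h2 e; have [? ?] := h1 e; have [? ?] := h2 e; auto.
- by move=> ? ? ? _ h e; have [? ?] := h e; auto.
- by move=> ? ? ? _ h e; have [? ?] := h e; auto.
- by move=> ? ? ? h1 _ h2 _ [-> ->].
Qed.

Lemma cutfree_meetP s t u :
  cutfree_le s (Tmeet t u) -> cutfree_le s t /\ cutfree_le s u.
Proof.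
move e : (Tmeet t u) => a sa; elim: sa e => //.
- by move=> ? ? ? _ h e; have [? ?] := h e; auto.
- by move=> ? ? ? _ h e; have [? ?] := h e; auto.
- by move=> ? ? ? h1 _ h2 _ [-> ->].
- by move=> ? ? ? _ h1 _ h2 e; have [? ?] := h1 e; have [? ?] := h2 e; auto.
Qed.

Lemma cutfree_refl s : cutfree_le s s.
Proof. by elim: s => *; auto. Qed.

(** Cut elimination, by induction on the cut term [t]. For a meet the left derivation is inverted
    and the induction runs on the right one; for a join it is the other way round. *)
Lemma cutfree_trans t s u : cutfree_le s t -> cutfree_le t u -> cutfree_le s u.
Proof.
elim: t s u => [x|t1 IH1 t2 IH2|t1 IH1 t2 IH2] s u.
- by move e : (Tvar x) => a sa; elim: sa e => // *; auto.
- move=> /cutfree_meetP[s1 s2]; move e : (Tmeet t1 t2) => a au.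
  by elim: au e => // [? ? ? ? _ [? ?]|? ? ? ? _ [? ?]|*|*|*]; subst; eauto.
- move=> + /cutfree_joinP[u1 u2]; move e : (Tjoin t1 t2) => a sa.
  by elim: sa e => // [*|*|? ? ? ? _ [? ?]|? ? ? ? _ [? ?]|*]; subst; eauto.
Qed.

Lemma term_le_cutfree s t : term_le s t -> cutfree_le s t.
Proof.
elim=> *; eauto using cutfree_refl, cutfree_trans.
Qed.

Lemma cutfree_term_le s t : cutfree_le s t -> term_le s t.
Proof.
elim=> *; eauto using term_le.
Qed.

End Whitman.

(** * Elements of a free lattice as terms *)

Section FreeLattice.
Variables (X : Type) (d : Order.disp_t) (L : latticeType d) (i : X -> L).
Hypothesis free_i : free_lattice_on i.
Implicit Types a b p q : L.

(** Mapping to the lattice of term classes and evaluating back is an endomorphism that fixes the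
    generators, hence the identity by uniqueness. *)
Lemma free_surj a : exists s, a = term_eval i s.
Proof.
have [h [[hI hU] hx _]] := free_i (fun x => to_class (Tvar x)).
have [h' [_ _ uniq]] := free_i i.
exists (of_class (h a)).
rewrite (uniq (fun a => term_eval i (of_class (h a)))).
- by rewrite -(uniq id).
- split=> b e /=.
  + by rewrite hI -{1}(of_classK (h b)) -{1}(of_classK (h e)) -to_class_meet
      term_eval_to_class.
  + by rewrite hU -{1}(of_classK (h b)) -{1}(of_classK (h e)) -to_class_join
      term_eval_to_class.
- by move=> x; rewrite hx term_eval_to_class.
Qed.

(** The homomorphism to the lattice of term classes sends the value of a term to its class, so every
    inequality in [L] is derivable. *)
Lemma free_le s t : term_eval i s <= term_eval i t -> cutfree_le s t.
Proof.
have [h [[hI hU] hx _]] := free_i (fun x => to_class (Tvar x)).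
have hE u : h (term_eval i u) = to_class u.
  elim: u => [x|u IHu v IHv|u IHu v IHv] /=; first exact: hx.
    by rewrite hI IHu IHv to_class_meet.
  by rewrite hU IHu IHv to_class_join.
move=> st; have : h (term_eval i s) <= h (term_eval i t).
  by rewrite leEmeet -hI (meet_l st).
by rewrite !hE to_class_le => /asboolP /term_le_cutfree.
Qed.

Lemma cutfree_free s t : cutfree_le s t -> term_eval i s <= term_eval i t.
Proof. by move=> /cutfree_term_le; exact: term_eval_le. Qed.

Lemma free_whitman p q a b : p `&` q <= a `|` b ->
  [\/ p <= a `|` b, q <= a `|` b, p `&` q <= a | p `&` q <= b].
Proof.
have [s ->] := free_surj p; have [t ->] := free_surj q.
have [u ->] := free_surj a; have [v ->] := free_surj b.
move=> /(@free_le (Tmeet s t) (Tjoin u v)) h; inversion h; subst.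
- by constructor 1; apply: (cutfree_free (t := Tjoin u v)).
- by constructor 2; apply: (cutfree_free (t := Tjoin u v)).
- by constructor 3; apply: (cutfree_free (s := Tmeet s t)).
- by constructor 4; apply: (cutfree_free (s := Tmeet s t)).
Qed.

Lemma free_gen_join_prime x a b : i x <= a `|` b -> i x <= a \/ i x <= b.
Proof.
have [u ->] := free_surj a; have [v ->] := free_surj b.
move=> /(@free_le (Tvar x) (Tjoin u v)) h; inversion h; subst.
- by left; apply: (cutfree_free (s := Tvar x)).
- by right; apply: (cutfree_free (s := Tvar x)).
Qed.

Lemma free_gen_meet_prime x a b : a `&` b <= i x -> a <= i x \/ b <= i x.
Proof.
have [u ->] := free_surj a; have [v ->] := free_surj b.
move=> /(@free_le (Tmeet u v) (Tvar x)) h; inversion h; subst.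
- by left; apply: (cutfree_free (t := Tvar x)).
- by right; apply: (cutfree_free (t := Tvar x)).
Qed.

Lemma free_gen_le x y : i x <= i y -> x = y.
Proof. by move=> /(@free_le (Tvar x) (Tvar y)) h; inversion h. Qed.

End FreeLattice.

(** * Canonical joinands *)

Section Joinands.
Variables (d : Order.disp_t) (L : latticeType d).
Implicit Types (a b u v w x : L) (s : seq L).

(* Nonempty joins only, since [L] need not have a least element. *)
Definition joins a s : L := foldr Order.join a s.

Lemma joins_leE a s b : (joins a s <= b) = all (<= b) (a :: s).
Proof.
elim: s => [|x s IH] /=; first by rewrite andbT.
by rewrite leUx IH /= andbCA.
Qed.

Lemma mem_le_joins a s x : x \in a :: s -> x <= joins a s.
Proof.
by move=> xs; have := lexx (joins a s); rewrite joins_leE => /allP; apply.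
Qed.

Definition join_irreducible u : Prop :=
  forall x y, u = x `|` y -> u = x \/ u = y.

Definition join_coprime w a : Prop :=
  forall u v, w = u `|` v -> a <= u \/ a <= v.

(** A characterization that quantifies over elements only, so that a first-order formula can state
    it; [v] acts as the join of the other joinands. *)
Definition canonical_joinand w u : Prop :=
  join_irreducible u /\
  exists v, [/\ w = u `|` v, ~ u <= v & forall x, w = x `|` v -> u <= x].

Lemma join_irreducible_joins a s : join_irreducible (joins a s) ->
  joins a s \in a :: s.
Proof.
elim: s => [|b s IH] /= irr; first by rewrite inE.
have [e|e] := irr _ _ erefl; first by rewrite e !inE eqxx /= orbT.
have : joins a s \in a :: s by apply: IH; rewrite -e.
by rewrite e !inE => /orP[->|->]; rewrite ?orbT.
Qed.

(** The members of [a :: s] not below the witness [v] have join [u]: each is below [u] by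
    coprimality, and [u] is below their join by minimality. Irreducibility then makes [u] one of
    them. *)
Lemma canonical_joinand_mem a s u :
  (forall b, b \in a :: s -> join_coprime (joins a s) b) ->
  canonical_joinand (joins a s) u -> u \in a :: s.
Proof.
set w := joins a s => cop [irr [v [wE uv umin]]].
case e : [seq b <- a :: s | ~~ (b <= v)] => [|b s'].
  case: uv; apply: (@le_trans _ _ w); first by rewrite wE leUl.
  rewrite joins_leE; apply/allP => b bs; apply: contraT => bv.
  have : b \in [seq b <- a :: s | ~~ (b <= v)] by rewrite mem_filter bv.
  by rewrite e.
have sub x : x \in b :: s' -> x \in a :: s.
  by rewrite -e mem_filter => /andP[].
have uE : u = joins b s'.
  apply: le_anti; apply/andP; split; last first.
    rewrite joins_leE; apply/allP => x; rewrite -e mem_filter => /andP[xv xs].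
    by have [//|xv'] := cop _ xs _ _ wE; rewrite xv' in xv.
  apply: umin; apply: le_anti; apply/andP; split; last first.
    rewrite leUx {2}wE leUr andbT joins_leE; apply/allP => x /sub.
    exact: mem_le_joins.
  rewrite joins_leE; apply/allP => x xs; have [xv|xv] := boolP (x <= v).
    by apply: le_trans xv _; exact: leUr.
  apply: le_trans (leUl _ _); apply: mem_le_joins.
  by rewrite -e mem_filter xv.
by apply: sub; rewrite {1}uE; apply: join_irreducible_joins; rewrite -uE.
Qed.

End Joinands.

(** * Finiteness of the canonical joinands in a free lattice *)

Section FreeJoinands.
Variables (X : Type) (d : Order.disp_t) (L : latticeType d) (i : X -> L).
Hypothesis free_i : free_lattice_on i.

(* In a term for [w] replace a meet by one of its factors as long as some factor
   is below [w]; by Whitman's condition the joinands that remain are coprime. *)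
Lemma free_joins_coprime (w : L) : exists a s,
  w = joins a s /\ forall b, b \in a :: s -> join_coprime w b.
Proof.
(* Generalized for the induction to all terms below [w]; for a term of [w] itself the two
   inequalities become the equality. *)
have H t : term_eval i t <= w -> exists a s,
    [/\ term_eval i t <= joins a s, joins a s <= w
      & forall b, b \in a :: s -> join_coprime w b].
  have single b : b <= w -> join_coprime w b -> exists a s,
      [/\ b <= joins a s, joins a s <= w
      & forall b, b \in a :: s -> join_coprime w b].
    by move=> bw wb; exists b, [::]; split=> // x; rewrite inE => /eqP->.
  elim: t => [x|t1 IH1 t2 IH2|t1 IH1 t2 IH2] /= tw.
  - apply: single => // u v wE; apply: free_gen_join_prime => //.
    by rewrite -wE.
  - have [/IH1[a [s [h1 h2 h3]]]|h1] := boolP (term_eval i t1 <= w).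
      by exists a, s; split=> //; apply: le_trans (leIl _ _) h1.
    have [/IH2[a [s [h2 h3 h4]]]|h2] := boolP (term_eval i t2 <= w).
      by exists a, s; split=> //; apply: le_trans (leIr _ _) h2.
    apply: single => // u v wE; move: tw; rewrite {1}wE.
    by case/(free_whitman free_i);
      rewrite -?wE; [rewrite (negPf h1)|rewrite (negPf h2)|left|right].
  - move: tw; rewrite leUx => /andP[/IH1[a1 [s1 [h1 w1 c1]]]].
    move=> /IH2[a2 [s2 [h2 w2 c2]]]; exists a1, (s1 ++ a2 :: s2).
    have memE x : x \in a1 :: s1 ++ a2 :: s2 =
        (x \in a1 :: s1) || (x \in a2 :: s2).
      by rewrite -cat_cons mem_cat.
    split.
    + rewrite leUx; apply/andP; split.
        apply: le_trans h1 _; rewrite joins_leE; apply/allP => x xs.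
        by apply: mem_le_joins; rewrite memE xs.
      apply: le_trans h2 _; rewrite joins_leE; apply/allP => x xs.
      by apply: mem_le_joins; rewrite memE xs orbT.
    + rewrite joins_leE -cat_cons all_cat.
      by move: w1 w2; rewrite !joins_leE => -> ->.
    + by move=> b; rewrite memE => /orP[/c1|/c2].
have [t wE] := free_surj free_i w.
have := H t; rewrite -wE => /(_ (lexx _))[a [s [h1 h2 h3]]].
by exists a, s; split=> //; apply: le_anti; rewrite h1.
Qed.

Lemma free_canonical_joinands_finite (w : L) :
  exists s : seq L, forall u, canonical_joinand w u -> u \in s.
Proof.
have [a [s [-> cop]]] := free_joins_coprime w.
by exists (a :: s) => u; exact: canonical_joinand_mem.
Qed.

End FreeJoinands.

(** * Independent elements in a free lattice with three generators *)

Section Chains.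
Variables (d : Order.disp_t) (L : latticeType d) (G : L -> Prop).
Hypothesis whitman : forall p q a b : L, p `&` q <= a `|` b ->
  [\/ p <= a `|` b, q <= a `|` b, p `&` q <= a | p `&` q <= b].
Hypothesis join_prime : forall g, G g ->
  forall a b, g <= a `|` b -> g <= a \/ g <= b.
Hypothesis meet_prime : forall g, G g ->
  forall a b, a `&` b <= g -> a <= g \/ b <= g.
Hypothesis antichain : forall g h, G g -> G h -> g <= h -> g = h.
Implicit Types (a b g h x y z : L).

Definition jm g h a : L := g `|` (h `&` a).

Lemma jm_mono g h a b : a <= b -> jm g h a <= jm g h b.
Proof. by move=> ab; rewrite /jm leU2 // leI2. Qed.

Lemma le_jm g h a : g <= jm g h a.
Proof. exact: leUl. Qed.

Lemma gen_le_jm (k : L) g h a : G k -> G g -> k <> g -> k <= jm g h a ->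
  k <= h /\ k <= a.
Proof.
move=> Gk Gg kg /(join_prime Gk)[/(antichain Gk Gg) //|].
by rewrite lexI => /andP[].
Qed.

(** The outer [jm g h] cancels. Whitman's condition is applied twice, and each time primeness and
    incomparability of the generators exclude all other alternatives; [~ a <= k] prevents [jm k g a]
    from collapsing to [k]. *)
Lemma jm_jm_le g h (k : L) a b : G g -> G h -> G k ->
    g <> h -> h <> k -> k <> g -> ~ a <= k ->
  jm g h (jm k g a) <= jm g h (jm k g b) -> jm k g a <= jm k g b.
Proof.
move=> Gg Gh Gk gh hk kg ak; rewrite {1}/jm leUx => /andP[_].
have hb : ~ h <= jm k g b.
  by move=> /(gen_le_jm Gh Gk hk)[] /(antichain Gh Gg) /esym /gh.
have hg : ~ h `&` jm k g a <= g.
  case/(meet_prime Gg) => [/(antichain Gh Gg) /esym /gh //|].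
  by move/(le_trans (le_jm _ _ _)) => /(antichain Gk Gg) /kg.
case/whitman.
- by move=> /(gen_le_jm Gh Gg (nesym gh))[].
- move=> /(le_trans (le_jm _ _ _)) /(gen_le_jm Gk Gg kg)[].
  by move=> /(antichain Gk Gh) /esym /hk.
- by move/hg.
- rewrite lexI => /andP[_]; case/whitman => [/hb|//||].
  + by [].
  + case/(meet_prime Gk) => [/(antichain Gh Gk) /hk //|].
    rewrite leUx => /andP[_] /(meet_prime Gk)[|//].
    by move=> /(antichain Gg Gk) /esym /kg.
  + by rewrite lexI => /andP[] /hg.
Qed.

(** * A polynomial that reflects the order *)

Section Phi.
Variables x y z : L.
Hypotheses (Gx : G x) (Gy : G y) (Gz : G z).
Hypotheses (xy : x <> y) (yz : y <> z) (zx : z <> x).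

(** Unfolded, joins and meets alternate in six operations; such a polynomial gives the classical
    infinite chain in the free lattice on three generators. *)
Definition phi a := jm x z (jm y x (jm z y a)).

Lemma phi_mono a b : a <= b -> phi a <= phi b.
Proof. by move=> ab; do 3 apply: jm_mono. Qed.

Lemma le_phi a : x <= phi a.
Proof. exact: le_jm. Qed.

Lemma phi_not_ge a : ~ y <= phi a.
Proof.
by move=> /(gen_le_jm Gy Gx (nesym xy))[] /(antichain Gy Gz) /yz.
Qed.

(** Two cancellations by [jm_jm_le] leave [jm z y a <= jm z y b]. The known form of [b] serves in
    the last layer, where the meet of [y] and [a] is below [b]: primeness of [x] or Whitman's
    condition for a join then applies. *)
Lemma phi_reflect a b : x <= a -> ~ y <= b ->
  b = x \/ (exists c, b = phi c) -> phi a <= phi b -> a <= b.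
Proof.
move=> xa yb bE ab.
have az : ~ a <= z.
  by move=> /(le_trans xa) /(antichain Gx Gz) /esym /zx.
have : jm z y a <= jm z y b.
  apply: (@jm_jm_le y x z) => //; [exact: nesym|exact: nesym|exact: nesym|].
  apply: (@jm_jm_le x z y) => //; [exact: nesym|exact: nesym|exact: nesym|].
  by move=> /(le_trans (le_jm _ _ _)) /(antichain Gz Gy) /esym /yz.
have yaz : ~ y `&` a <= z.
  by case/(meet_prime Gz) => // /(antichain Gy Gz) /yz.
have yax : y `&` a <= x -> a <= x.
  by case/(meet_prime Gx) => // /(antichain Gy Gx) /esym /xy.
rewrite leUx => /andP[_] /whitman [||/yaz //|].
- by move=> /(gen_le_jm Gy Gz yz)[].
- move=> /(le_trans xa) /(gen_le_jm Gx Gz (nesym zx))[].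
  by move=> /(antichain Gx Gy) /xy.
- rewrite lexI => /andP[_]; case: bE yb => [->|[c ->]] yb; first by [].
  case/whitman => [//|//|/yax h|].
    exact: le_trans h (le_phi c).
  by rewrite lexI => /andP[/yaz].
Qed.

End Phi.

(** * Two chains and the antichain of their meets *)

Section Sequences.
Variables x y z : L.
Hypotheses (Gx : G x) (Gy : G y) (Gz : G z).
Hypotheses (xy : x <> y) (yz : y <> z) (zx : z <> x).
Let yx := nesym xy.
Let zy := nesym yz.
Let xz := nesym zx.

Definition up n := iter n (phi x y z) x.
(** The start is the largest element of the sublattice generated by [x], [y], [z], so the iterates
    descend. Even [down 0] has undergone one application of [phi], so that every [down n] is above
    [y] but not above [x]. *)
Definition down n := iter n.+1 (phi y x z) (x `|` y `|` z).

Lemma le_up n : x <= up n.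
Proof. by case: n => [|n] //=; exact: le_phi. Qed.

Lemma le_down n : y <= down n.
Proof. exact: le_phi. Qed.

Lemma up_not_ge n : ~ y <= up n.
Proof.
by case: n => [/(antichain Gy Gx) //|n]; exact: (phi_not_ge Gx Gy Gz).
Qed.

Lemma down_not_ge n : ~ x <= down n.
Proof. exact: (phi_not_ge Gy Gx Gz). Qed.

Lemma up_mono m n : (m <= n)%N -> up m <= up n.
Proof.
elim: m n => [|m IH] [|n] //; first by move=> _; exact: le_up.
by rewrite ltnS => /IH; exact: phi_mono.
Qed.

Lemma down_mono m n : (m <= n)%N -> down n <= down m.
Proof.
elim: m n => [|m IH] [|n] // => [_|]; last first.
  by rewrite ltnS => /IH; exact: phi_mono.
apply: phi_mono; rewrite /= {1}/phi {1}/jm leUx.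
by rewrite (le_trans (leUr y x) (leUl _ z)) (le_trans (leIl _ _) (leUr _ _)).
Qed.

Lemma up_le m n : up m <= up n -> (m <= n)%N.
Proof.
elim: m n => // m IH [|n].
  move=> h; have : jm y x (jm z y (up m)) <= x \/ z <= x.
    have : z `&` jm y x (jm z y (up m)) <= x by apply: le_trans (leUr _ _) h.
    by case/(meet_prime Gx); [right|left].
  case=> [|/(antichain Gz Gx) //].
  by move=> /(le_trans (le_jm _ _ _)) /(antichain Gy Gx).
move=> /(phi_reflect Gx Gy Gz xy yz zx (le_up m) (@up_not_ge n)) h.
apply: IH; apply: h.
by case: n => [|n]; [left|right; exists (up n)].
Qed.

Lemma down_le m n : down m <= down n -> (n <= m)%N.
Proof.
elim: n m => // n IH m.
move=> /(phi_reflect Gy Gx Gz yx xz zy _ (@down_not_ge n)) h.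
have {h} : iter m (phi y x z) (x `|` y `|` z) <= down n.
  apply: h; last by right; eexists.
  by case: m => [|m] /=; [exact: le_trans (leUr y x) (leUl _ z)|exact: le_phi].
case: m => [|m]; last by move/IH.
(* Here the left side is the starting element, which is above [x]. *)
by move=> /(le_trans (le_trans (leUl x y) (leUl _ z))) /down_not_ge.
Qed.

(** The factor [down j] is above [y] and cannot be responsible. With [up k] equal to [x] or split as
    a join, only [up i <= up k] or [up i <= x] survives. *)
Lemma up_down_le_up i j k : up i `&` down j <= up k -> (i <= k)%N.
Proof.
have upx : up i <= x -> (i <= k)%N.
  by move=> h; have := @up_le i 0 h; case: (i) h.
have jx : ~ down j <= x.
  by move=> /(le_trans (le_down _)) /(antichain Gy Gx).
case: k upx => [|k] upx.
  by case/(meet_prime Gx) => // /(@up_le _ 0).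
case/whitman => [/(@up_le _ k.+1) //|||].
- by move=> /(le_trans (le_down _)) /(@up_not_ge k.+1).
- by case/(meet_prime Gx).
- rewrite lexI => /andP[/(meet_prime Gz)[|] h _].
    by have /(antichain Gx Gz) := le_trans (le_up _) h.
  by have /(antichain Gy Gz) := le_trans (le_down _) h.
Qed.

Lemma up_down_le_down i j k : up i `&` down j <= down k -> (k <= j)%N.
Proof.
case/whitman => [|/(@down_le _ k) //||].
- by move=> /(le_trans (le_up _)) /(@down_not_ge k).
- case/(meet_prime Gy) => [|h].
    by move=> /(le_trans (le_up _)) /(antichain Gx Gy).
  move: h; rewrite leUx => /andP[_] /(meet_prime Gy)[/(antichain Gz Gy) //|].
  by move=> /(le_trans (le_jm _ _ _)) /(antichain Gx Gy).
- rewrite lexI => /andP[/(meet_prime Gz)[|] h _].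
    by have /(antichain Gx Gz) := le_trans (le_up _) h.
  by have /(antichain Gy Gz) := le_trans (le_down _) h.
Qed.

Definition pt n := up n `&` down n.

Lemma gen_le_pt n : ~ x <= pt n /\ ~ y <= pt n.
Proof.
by rewrite !lexI; split=> /andP[]; [move=> _ /down_not_ge|move=> /up_not_ge].
Qed.

(** Comparison with the ascending factor gives [m <= n] and with the descending one [n <= m], so the
    points form an antichain. *)
Lemma pt_inj m n : pt m <= pt n -> m = n.
Proof.
rewrite lexI => /andP[/up_down_le_up h1 /up_down_le_down h2].
by apply/eqP; rewrite eqn_leq h1.
Qed.

(** Of the four alternatives of Whitman's condition, the first two would put [x] (below [up n]) or
    [y] (below [down n]) below the join. *)
Lemma pt_le_join n a b : ~ x <= a `|` b -> ~ y <= a `|` b ->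
  pt n <= a `|` b -> pt n <= a \/ pt n <= b.
Proof.
move=> xab yab; case/whitman; [| |by left|by right].
- by move/(le_trans (le_up n)).
- by move/(le_trans (le_down n)).
Qed.

(** * Codes of numbers and finite relations *)

Lemma gen_le_joins g a s : G g -> g <= joins a s ->
  exists2 b, b \in a :: s & g <= b.
Proof.
move=> Gg; elim: s => [|b s IH] /=.
  by exists a => //; rewrite mem_seq1.
case/(join_prime Gg) => [gb|/IH[e es ge]].
  by exists b => //; rewrite !inE eqxx orbT.
by exists e => //; move: es; rewrite !inE => /orP[]->; rewrite ?orbT.
Qed.

Lemma meet_le_joins p q a s : ~ p <= joins a s -> ~ q <= joins a s ->
  p `&` q <= joins a s -> exists2 b, b \in a :: s & p `&` q <= b.
Proof.
elim: s => [|b s IH] /= pa qa.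
  by exists a => //; rewrite mem_seq1.
case/whitman => // [h|h]; first by exists b => //; rewrite !inE eqxx orbT.
have [||e es pqe] := IH _ _ h.
- by move=> h1; apply: pa; apply: le_trans h1 (leUr _ _).
- by move=> h1; apply: qa; apply: le_trans h1 (leUr _ _).
- by exists e => //; move: es; rewrite !inE => /orP[]->; rewrite ?orbT.
Qed.

(** The points 0 and 1 are kept for the parameters that mark the first and the second coordinate of
    a pair in [cell]. *)
Definition num n := pt n.+2.
Definition cell u v : L := (u `|` pt 0) `&` (v `|` pt 1).
(* The joinand [pt 0 `&` pt 1] lies above no [cell (num i) (num j)]; it allows
   for an empty [R]. *)
Definition relation_code (R : seq (nat * nat)) : L :=
  joins (pt 0 `&` pt 1) [seq cell (num p.1) (num p.2) | p <- R].
Definition line K : L := joins (num 0) [seq num j | j <- iota 1 K].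

Lemma gen_not_le_num_join i n : ~ x <= num i `|` pt n /\ ~ y <= num i `|` pt n.
Proof.
have [x1 y1] := gen_le_pt i.+2; have [x2 y2] := gen_le_pt n.
by split; [case/(join_prime Gx)|case/(join_prime Gy)].
Qed.

Lemma gen_not_le_code R : ~ x <= relation_code R /\ ~ y <= relation_code R.
Proof.
have [x0 y0] := gen_le_pt 0.
split; [move=> /(gen_le_joins Gx)[b]|move=> /(gen_le_joins Gy)[b]];
  rewrite inE => /orP[/eqP->|/mapP[p _ ->]]; rewrite lexI => /andP[] //;
  by have [? ?] := gen_not_le_num_join p.1 0.
Qed.

(** Since neither [pt 0] nor [pt 1] is below the code, Whitman's condition puts a cell that is below
    the code under a single joinand; comparing the two factors then identifies the pair. *)
Lemma relation_codeP R i j :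
  cell (num i) (num j) <= relation_code R <-> (i, j) \in R.
Proof.
have [xR yR] := gen_not_le_code R.
split=> [|ijR]; last first.
  apply: mem_le_joins; rewrite inE; apply/orP; right.
  by apply/mapP; exists (i, j).
have n01 m n : pt m <= pt n -> m = n by exact: pt_inj.
have cd_le n : pt 0 `&` pt 1 <= pt n -> (n <= 1)%N.
  (* A meet of two chain elements below both points, to which [up_down_le_down] applies. *)
  have h01 : up 0 `&` down 1 <= pt 0 `&` pt 1.
    rewrite /pt !lexI leIl leIr (le_trans (leIr _ _) (down_mono _)) //.
    by rewrite (le_trans (leIl _ _) (up_mono _)).
  move=> h; apply: (@up_down_le_down 0 1).
  exact: le_trans (le_trans h01 h) (leIr _ _).
(* Again a meet of chain elements lies below both numbers, with the lesser index for [up] and the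
   greater one for [down]. *)
have num_le n : num i `&` num j <= pt n -> (1 < n)%N.
  move=> h; apply: (@leq_trans (minn i j).+2) => //.
  apply: (@up_down_le_up _ (maxn i j).+2).
  apply: le_trans (le_trans h (leIl _ _)).
  have mono k : (minn i j <= k)%N -> (k <= maxn i j)%N ->
      up (minn i j).+2 `&` down (maxn i j).+2 <= num k.
    by move=> ? ?; rewrite /num /pt leI2 ?up_mono ?down_mono.
  by rewrite lexI !mono ?geq_minl ?geq_minr ?leq_maxl ?leq_maxr.
have numcell : num i `&` num j <= cell (num i) (num j).
  by rewrite /cell leI2 // leUl.
have ptcell : pt 0 `&` pt 1 <= cell (num i) (num j).
  by rewrite /cell leI2 // leUr.
have num_not n k m : n != k.+2 -> n != m -> ~ pt n <= num k `|` pt m.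
  move=> nk nm; have [h1 h2] := gen_not_le_num_join k m.
  by case/(pt_le_join h1 h2) => /n01 e; rewrite e eqxx in nk nm.
(* [pt 0] fails at the second factor of every cell and [pt 1] at the first. *)
have c0 n : (n <= 1)%N -> ~ pt n <= relation_code R.
  move=> n1 h.
  have [||b] := meet_le_joins _ _ h.
  - by move=> /(le_trans (le_up _)).
  - by move=> /(le_trans (le_down _)).
  rewrite inE => /orP[/eqP->|/mapP[[k l] _ ->]]; rewrite lexI => /andP[].
    by move=> /n01 e0 /n01; rewrite e0.
  move=> /= h0 h1; case: n n1 h h0 h1 => [|[|//]] _ _ h0 h1.
    by move: h1; apply: num_not.
  by move: h0; apply: num_not.
case/meet_le_joins.
- by rewrite leUx => /andP[_]; apply: c0.
- by rewrite leUx => /andP[_]; apply: c0.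
move=> b; rewrite inE => /orP[/eqP->|/mapP[[k l] klR ->]] /=.
  rewrite lexI => /andP[h _]; have := num_le 0 (le_trans numcell h).
  by [].
rewrite lexI => /andP[h1 h2].
suff [-> ->] : i = k /\ j = l by [].
split.
- case/whitman: h1.
  + rewrite leUx => /andP[h _]; apply/eqP; apply: contraT => ik.
    by case: (num_not i.+2 k 0 _ _ h).
  + rewrite leUx => /andP[_ h].
    by case: (num_not 1 k 0 _ _ h).
  + by move=> /(le_trans ptcell) /cd_le.
  + by move=> /(le_trans numcell) /num_le.
- case/whitman: h2.
  + rewrite leUx => /andP[_ h].
    by case: (num_not 0 l 1 _ _ h).
  + rewrite leUx => /andP[h _]; apply/eqP; apply: contraT => jl.
    by case: (num_not j.+2 l 1 _ _ h).
  + by move=> /(le_trans ptcell) /cd_le.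
  + by move=> /(le_trans numcell) /num_le.
Qed.

Lemma mem_line K u :
  (u \in num 0 :: [seq num j | j <- iota 1 K]) <->
  exists2 j, (j <= K)%N & u = num j.
Proof.
rewrite (_ : num 0 :: _ = [seq num j | j <- iota 0 K.+1]) //.
split=> [/mapP[j]|[j jK ->]].
  by rewrite mem_iota add0n ltnS => jK ->; exists j.
by apply: map_f; rewrite mem_iota add0n ltnS.
Qed.

Lemma gen_not_le_line K : ~ x <= line K /\ ~ y <= line K.
Proof.
split; [move=> /(gen_le_joins Gx)[b]|move=> /(gen_le_joins Gy)[b]];
  by move=> /mem_line[j _ ->]; have [? ?] := gen_le_pt j.+2.
Qed.

Lemma num_coprime K j a b : line K = a `|` b -> (j <= K)%N ->
  num j <= a \/ num j <= b.
Proof.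
have [xK yK] := gen_not_le_line K => e jK.
apply: (@pt_le_join _ a b); rewrite -e //.
by apply: mem_le_joins; apply/mem_line; exists j.
Qed.

Lemma line_joinandP K u : canonical_joinand (line K) u <->
  exists2 j, (j <= K)%N & u = num j.
Proof.
rewrite -mem_line; split.
  apply: canonical_joinand_mem => b /mem_line[j jK ->] a e aeK.
  exact: num_coprime aeK jK.
move=> /mem_line[j jK ->]; split.
  move=> a b e; have [xj yj] := gen_le_pt j.+2.
  have [|||h|h] := @pt_le_join j.+2 a b; rewrite -?e //.
  - by left; apply: le_anti; rewrite h e leUl.
  - by right; apply: le_anti; rewrite h e leUr.
(* The complement that a canonical joinand requires: the join of the other numbers. The base element
   keeps this join nonempty when [K = 0] and is above no number. *)
pose v := joins (num 0 `&` num 1) [seq num k | k <- iota 0 K.+1 & k != j].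
have numv : ~ num j <= v.
  move=> jv.
  have vb b :
      b \in num 0 `&` num 1 :: [seq num k | k <- iota 0 K.+1 & k != j] ->
      exists n, b <= num n.
    rewrite inE => /orP[/eqP->|/mapP[k _ ->]]; first by exists 0; exact: leIl.
    by exists k.
  have h1 : ~ x <= v.
    move=> /(gen_le_joins Gx)[b /vb[k bk] /le_trans /(_ bk)].
    by have [] := gen_le_pt k.+2.
  have h2 : ~ y <= v.
    move=> /(gen_le_joins Gy)[b /vb[k bk] /le_trans /(_ bk)].
    by have [] := gen_le_pt k.+2.
  have [||b] := meet_le_joins _ _ jv.
  - by move=> /(le_trans (le_up _)).
  - by move=> /(le_trans (le_down _)).
  rewrite inE => /orP[/eqP->|/mapP[k + ->]].
    by rewrite lexI => /andP[/pt_inj -> /pt_inj].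
  by rewrite mem_filter => /andP[kj _] /pt_inj[] e; rewrite e eqxx in kj.
exists v; split => //.
- apply: le_anti; apply/andP; split.
    rewrite joins_leE; apply/allP => b /mem_line[k kK ->].
    have [->|kj] := eqVneq k j; first exact: leUl.
    apply: le_trans (leUr _ _); apply: mem_le_joins; rewrite inE.
    by apply/orP; right; apply: map_f; rewrite mem_filter kj mem_iota.
  rewrite leUx; apply/andP; split.
    by apply: mem_le_joins; apply/mem_line; exists j.
  rewrite joins_leE; apply/allP => b; rewrite inE => /orP[/eqP->|/mapP[k + ->]].
    by apply: le_trans (leIl _ _) _; apply: mem_le_joins; rewrite inE eqxx.
  rewrite mem_filter mem_iota => /andP[_] kK.
  by apply: mem_le_joins; apply/mem_line; exists k.
- by move=> a /num_coprime /(_ jK)[].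
Qed.

End Sequences.
End Chains.

(** * First-order formulas *)

(* In [Fjoin k], [Fnum k], ... the bound variables are numbered from [k], so the
   free ones have to be less than [k].  The variables 0, 1, 2, 3 are parameters:
   the numbers are the canonical joinands of 0, and [r] encodes the set of pairs
   [(u, u')] of numbers with [(u `|` v 1) `&` (u' `|` v 2) <= r]; the value of 3
   encodes the order of the numbers. *)
Definition Fjoin k z x y :=
  Fall k (Fand (Fimp (Fle z k) (Fand (Fle x k) (Fle y k)))
               (Fimp (Fand (Fle x k) (Fle y k)) (Fle z k))).
Definition Firreducible k u :=
  Fall k (Fall k.+1 (Fimp (Fjoin k.+2 u k k.+1) (For (Feq u k) (Feq u k.+1)))).
Definition Fnum k u :=
  Fand (Firreducible k u)
    (Fex k (Fand (Fjoin k.+1 0 u k)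
      (Fand (Fneg (Fle u k))
        (Fall k.+1 (Fimp (Fjoin k.+2 0 k.+1 k) (Fle u k.+1)))))).
Definition Frel k r u u' :=
  Fex k (Fex k.+1 (Fand (Fjoin k.+2 k u 1) (Fand (Fjoin k.+2 k.+1 u' 2)
    (Fall k.+2 (Fimp (Fand (Fle k.+2 k) (Fle k.+2 k.+1)) (Fle k.+2 r)))))).
Definition Flt k u u' := Frel k 3 u u'.
Definition Falln k p := Fall k (Fimp (Fnum k.+1 k) p).
Definition Fexn k p := Fex k (Fand (Fnum k.+1 k) p).
Definition Fzero k u := Falln k (Fneg (Flt k.+1 k u)).
Definition Fsucc k u u' :=
  Fand (Flt k u u') (Falln k (Fimp (Flt k.+1 u k) (Fneg (Flt k.+1 k u')))).
Definition Forder :=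
  Falln 4 (Fand (Fneg (Flt 5 4 4))
    (Falln 5 (Fand (For (Flt 6 4 5) (For (Feq 4 5) (Flt 6 5 4)))
      (Falln 6 (Fimp (Flt 7 4 5) (Fimp (Flt 7 5 6) (Flt 7 4 6))))))).

(** * Bounds on the free variables of the formulas *)

Definition closed_below k p := all (fun y => y < k)%N (free_vars p).

Section ClosedBelow.
Implicit Types (k : nat) (p q : formula).

Lemma closed_all k p : closed_below k.+1 p -> closed_below k (Fall k p).
Proof.
move=> /allP pk; apply/allP => y; rewrite mem_filter => /andP[yk /pk].
by rewrite ltnS leq_eqVlt (negPf yk).
Qed.

Lemma closed_ex k p : closed_below k.+1 p -> closed_below k (Fex k p).
Proof. exact: closed_all. Qed.

Lemma closed_neg k p : closed_below k (Fneg p) = closed_below k p.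
Proof. by []. Qed.

Lemma closed_and k p q :
  closed_below k (Fand p q) = closed_below k p && closed_below k q.
Proof. exact: all_cat. Qed.

Lemma closed_or k p q :
  closed_below k (For p q) = closed_below k p && closed_below k q.
Proof. exact: all_cat. Qed.

Lemma closed_imp k p q :
  closed_below k (Fimp p q) = closed_below k p && closed_below k q.
Proof. exact: all_cat. Qed.

Lemma closed_le k x y : closed_below k (Fle x y) = (x < k)%N && (y < k)%N.
Proof. by rewrite /closed_below /= andbT. Qed.

Lemma closed_eq k x y : closed_below k (Feq x y) = (x < k)%N && (y < k)%N.
Proof. by rewrite /closed_below /= andbT. Qed.

Definition closedE :=
  (closed_neg, closed_and, closed_or, closed_imp, closed_le, closed_eq).

Lemma closed_belowW k k' p : (k <= k')%N -> closed_below k p ->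
  closed_below k' p.
Proof. by move=> kk' /allP pk; apply/allP => y /pk /leq_trans; apply. Qed.

Lemma closed_join k z x y : (z < k)%N -> (x < k)%N -> (y < k)%N ->
  closed_below k (Fjoin k z x y).
Proof. by move=> zk xk yk; apply: closed_all; rewrite !closedE; lia. Qed.

Lemma closed_num k u : (0 < k)%N -> (u < k)%N -> closed_below k (Fnum k u).
Proof.
move=> k0 uk; rewrite closed_and; apply/andP; split.
  do 2 apply: closed_all; rewrite !closedE closed_join /=; lia.
apply: closed_ex; rewrite closed_and closed_join ?closed_and; [|lia..].
rewrite !closedE (_ : closed_below k.+1 (Fall _ _)); first by lia.
by apply: closed_all; rewrite !closedE closed_join; lia.
Qed.

Lemma closed_rel k r u u' : (2 < k)%N -> (r < k)%N -> (u < k)%N ->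
  (u' < k)%N -> closed_below k (Frel k r u u').
Proof.
move=> *; do 2 apply: closed_ex; rewrite !closed_and !closed_join; [|lia..].
by apply: closed_all; rewrite !closedE; lia.
Qed.

Lemma closed_lt k u u' : (3 < k)%N -> (u < k)%N -> (u' < k)%N ->
  closed_below k (Flt k u u').
Proof. by move=> *; apply: closed_rel; lia. Qed.

Lemma closed_alln k p : closed_below k.+1 p -> closed_below k (Falln k p).
Proof. by move=> *; apply: closed_all; rewrite closed_imp closed_num. Qed.

Lemma closed_exn k p : closed_below k.+1 p -> closed_below k (Fexn k p).
Proof. by move=> *; apply: closed_ex; rewrite closed_and closed_num. Qed.

Lemma closed_zero k u : (3 < k)%N -> (u < k)%N -> closed_below k (Fzero k u).
Proof.
by move=> *; apply: closed_alln; rewrite closed_neg; apply: closed_lt; lia.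
Qed.

Lemma closed_succ k u u' : (3 < k)%N -> (u < k)%N -> (u' < k)%N ->
  closed_below k (Fsucc k u u').
Proof.
move=> *; rewrite closed_and closed_lt; [|lia..].
by apply: closed_alln; rewrite !closedE !closed_lt; lia.
Qed.

Lemma closed_order : closed_below 4 Forder.
Proof. by []. Qed.

End ClosedBelow.

(** * Meaning of the formulas *)

Section Update.
Variables (T : Type) (v : nat -> T) (k : nat) (a : T).

Lemma update_same : update v k a k = a.
Proof. by rewrite /update eqxx. Qed.

Lemma update_other j : j != k -> update v k a j = v j.
Proof. by rewrite /update => /negPf->. Qed.

End Update.

Ltac upd := repeat (rewrite update_same || (rewrite update_other; [|lia])).

Definition related d (L : latticeType d) (c e r u u' : L) : bool :=
  (u `|` c) `&` (u' `|` e) <= r.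

Lemma sat_join d (L : latticeType d) (v : nat -> L) k z x y :
  (z < k)%N -> (x < k)%N -> (y < k)%N ->
  satisfies v (Fjoin k z x y) = (v z = v x `|` v y).
Proof.
move=> zk xk yk; apply: propext; rewrite /Fjoin /=; split=> [h|e a]; last first.
  by upd; rewrite e leUx; split=> [/andP[]|[-> ->]].
apply: le_anti; apply/andP; split.
  by have [_] := h (v x `|` v y); upd; rewrite leUl leUr; apply.
by have [+ _] := h (v z); upd; rewrite lexx leUx => /(_ isT)[-> ->].
Qed.

Opaque Fjoin.

Lemma sat_num d (L : latticeType d) (v : nat -> L) k u :
  (0 < k)%N -> (u < k)%N ->
  satisfies v (Fnum k u) = canonical_joinand (v 0) (v u).
Proof.
move=> k0 uk; apply: propext; rewrite /Fnum /Firreducible /=.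
split=> -[h1 [a h2]]; split.
- move=> x y; have := h1 x y; rewrite sat_join; [|lia..]; upd; exact.
- exists a; move: h2; rewrite sat_join; [|lia..]; upd => -[h2 [h3 h4]].
  by split=> // x; have := h4 x; rewrite sat_join; [|lia..]; upd.
- move=> x y; rewrite sat_join; [|lia..]; upd; exact: h1.
- case: h2 => h2 h3 h4; exists a; rewrite sat_join; [|lia..]; upd.
  by do 2 split=> //; move=> x; rewrite sat_join; [|lia..]; upd; apply: h4.
Qed.

Lemma sat_rel d (L : latticeType d) (v : nat -> L) k r u u' :
  (2 < k)%N -> (r < k)%N -> (u < k)%N -> (u' < k)%N ->
  satisfies v (Frel k r u u') = related (v 1) (v 2) (v r) (v u) (v u').
Proof.
move=> k2 rk uk u'k; apply: propext; rewrite /Frel /related /=; split.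
  move=> [a [b]]; do 2 (rewrite sat_join; [|lia..]); upd => -[-> [->]].
  set t := _ `&` _; move=> /(_ t); upd; apply.
  by rewrite leIl leIr.
move=> h; exists (v u `|` v 1), (v u' `|` v 2).
do 2 (rewrite sat_join; [|lia..]); upd; split=> //; split=> // t; upd.
by move=> [tu tu']; apply: le_trans h; rewrite lexI tu tu'.
Qed.

Lemma sat_lt d (L : latticeType d) (v : nat -> L) k u u' :
  (3 < k)%N -> (u < k)%N -> (u' < k)%N ->
  satisfies v (Flt k u u') = related (v 1) (v 2) (v 3) (v u) (v u').
Proof. by move=> *; apply: sat_rel; lia. Qed.

Opaque Fnum Frel Flt.

Lemma sat_alln d (L : latticeType d) (v : nat -> L) k p :
  (0 < k)%N -> satisfies v (Falln k p) =
  (forall a, canonical_joinand (v 0) a -> satisfies (update v k a) p).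
Proof.
move=> k0; apply: propext; rewrite /Falln /=; split=> h a;
  by have := h a; rewrite sat_num; [|lia..]; upd.
Qed.

Lemma sat_exn d (L : latticeType d) (v : nat -> L) k p :
  (0 < k)%N -> satisfies v (Fexn k p) =
  (exists2 a, canonical_joinand (v 0) a & satisfies (update v k a) p).
Proof.
move=> k0; apply: propext; rewrite /Fexn /=.
by split=> [[a]|[a h1 h2]]; [|exists a];
  rewrite sat_num; try lia; upd; [case; exists a|].
Qed.

Opaque Falln Fexn.

(** * Numberings of the canonical joinands *)

Section Numbering.
Variables (d : Order.disp_t) (L : latticeType d).
Implicit Types (a b : L) (v : nat -> L) (val : L -> nat) (k n x z : nat).

(** An order isomorphism of the canonical joinands of [v 0] onto an initial segment of the natural
    numbers; the last clause excludes gaps. *)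
Definition numbering v val : Prop :=
  [/\ forall a b, canonical_joinand (v 0) a -> canonical_joinand (v 0) b ->
        val a = val b -> a = b,
      forall a b, canonical_joinand (v 0) a -> canonical_joinand (v 0) b ->
        related (v 1) (v 2) (v 3) a b = (val a < val b)%N
    & forall a n, canonical_joinand (v 0) a -> (n < val a)%N ->
        exists2 b, canonical_joinand (v 0) b & val b = n].

Definition strict_order v : Prop :=
  [/\ forall a, canonical_joinand (v 0) a ->
        ~ related (v 1) (v 2) (v 3) a a,
      forall a b, canonical_joinand (v 0) a -> canonical_joinand (v 0) b ->
        [\/ related (v 1) (v 2) (v 3) a b, a = b
          | related (v 1) (v 2) (v 3) b a]
    & forall a b e, canonical_joinand (v 0) a -> canonical_joinand (v 0) b ->
        canonical_joinand (v 0) e -> related (v 1) (v 2) (v 3) a b ->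
        related (v 1) (v 2) (v 3) b e -> related (v 1) (v 2) (v 3) a e].

Lemma sat_order v : satisfies v Forder <-> strict_order v.
Proof.
rewrite /Forder sat_alln //; split=> [h|[irr tot tr] a ca /=].
  split.
  - by move=> a ca; have /= [+ _] := h a ca; rewrite sat_lt //; upd.
  - move=> a b ca cb; have /= [_] := h a ca; rewrite sat_alln //; upd.
    move=> /(_ b cb) /= [+ _]; rewrite !sat_lt //; upd.
    by case=> [|[|]]; [constructor 1|constructor 2|constructor 3].
  - move=> a b e ca cb ce; have /= [_] := h a ca; rewrite sat_alln //; upd.
    move=> /(_ b cb) /= [_]; rewrite sat_alln //; upd.
    by move=> /(_ e ce) /=; rewrite !sat_lt //; upd.
rewrite sat_lt // sat_alln //; upd; split; first exact: irr.
move=> b cb /=; rewrite !sat_lt // sat_alln //; upd; split.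
  by have [] := tot a b ca cb; [left|right; left|right; right].
by move=> e ce /=; rewrite !sat_lt //; upd; apply: tr.
Qed.

Lemma numbering_strict_order v val : numbering v val -> strict_order v.
Proof.
move=> [inj ltE _]; split=> [a ca|a b ca cb|a b e ca cb ce].
- by rewrite ltE // ltnn.
- rewrite !ltE //; case: (ltngtP (val a) (val b)) => [||/inj e].
  + by constructor 1.
  + by constructor 3.
  + by constructor 2; apply: e.
- by rewrite !ltE //; exact: ltn_trans.
Qed.

(* The value of [a] is the number of its predecessors. *)
Lemma finite_numbering v (s : seq L) :
  (forall a, canonical_joinand (v 0) a -> a \in s) ->
  strict_order v -> exists val, numbering v val.
Proof.
move=> fin [irr tot tr].
pose t := [seq a <- undup s | `[< canonical_joinand (v 0) a >]].
have tE a : a \in t <-> canonical_joinand (v 0) a.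
  rewrite mem_filter mem_undup; split=> [/andP[/asboolP]//|ca].
  by rewrite fin // andbT; apply/asboolP.
have ut : uniq t by rewrite filter_uniq // undup_uniq.
pose lt a b := related (v 1) (v 2) (v 3) a b.
pose val b := count (lt^~ b) t.
have count_lt (p q : pred L) a : a \in t -> ~~ p a -> q a ->
    (forall b, b \in t -> p b -> q b) -> (count p t < count q t)%N.
  move=> ta pa qa pq; have /permP tp := perm_to_rem ta.
  rewrite !tp /= (negPf pa) qa add0n ltnS -!size_filter.
  apply: uniq_leq_size => [|b]; first by rewrite filter_uniq // rem_uniq.
  by rewrite !mem_filter => /andP[pb bt]; rewrite bt pq // (mem_rem bt).
have val_lt a b : a \in t -> b \in t -> lt a b -> (val a < val b)%N.
  move=> ta tb ab; apply: (count_lt _ _ a) => //.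
    by apply/negP; apply: irr; apply/tE.
  by move=> e te ea; apply: (@tr e a b) => //; apply/tE.
have inj : {in t &, injective val}.
  move=> a b ta tb vab; have [||ab|//|ba] := tot a b; try exact/tE.
    by have := val_lt a b ta tb ab; rewrite vab ltnn.
  by have := val_lt b a tb ta ba; rewrite vab ltnn.
exists val; split.
- by move=> a b /tE ta /tE tb; exact: inj.
- move=> a b /tE ta /tE tb; apply/idP/idP; first exact: val_lt.
  move=> ab; have [||//|e|ba] := tot a b; try exact/tE.
    by rewrite e ltnn in ab.
  by have := val_lt b a tb ta ba; rewrite ltnNge (ltnW ab).
- move=> a n /tE ta na.
  have val_size b : b \in t -> (val b < size t)%N.
    move=> tb; rewrite -(count_predT t); apply: (count_lt _ _ b) => //.
    by apply/negP; apply: irr; apply/tE.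
  (* The [size t] distinct values all lie below [size t], so they exhaust that segment. *)
  have [|||_ memE] := @uniq_min_size _ [seq val b | b <- t] (iota 0 (size t)).
  - by rewrite map_inj_in_uniq.
  - by move=> m /mapP[b tb ->]; rewrite mem_iota add0n val_size.
  - by rewrite size_map size_iota.
  have : n \in iota 0 (size t).
    by rewrite mem_iota add0n; exact: ltn_trans na (val_size a ta).
  by rewrite -memE => /mapP[b /tE cb ->]; exists b.
Qed.

Lemma sat_zero v val k x : numbering v val -> (3 < k)%N -> (x < k)%N ->
  canonical_joinand (v 0) (v x) ->
  satisfies v (Fzero k x) = (val (v x) = 0).
Proof.
move=> [_ ltE gap] k3 xk cx; apply: propext; rewrite /Fzero sat_alln; last lia.
split=> [h|x0 a ca /=].
  apply/eqP; apply: contraT; rewrite -lt0n => x0.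
  have [a ca a0] := gap _ _ cx x0.
  have := h a ca; rewrite /= sat_lt; [|lia..]; upd.
  by rewrite ltE // a0.
by rewrite sat_lt; [|lia..]; upd; rewrite ltE // x0.
Qed.

Lemma sat_succ v val k x z : numbering v val -> (3 < k)%N -> (x < k)%N ->
  (z < k)%N -> canonical_joinand (v 0) (v x) ->
  canonical_joinand (v 0) (v z) ->
  satisfies v (Fsucc k x z) = (val (v z) = (val (v x)).+1).
Proof.
move=> [_ ltE gap] k3 xk zk cx cz; apply: propext; rewrite /Fsucc /=.
rewrite sat_lt; [|lia..]; rewrite sat_alln; [|lia..]; rewrite ltE //.
split=> [[xz h]|zx].
  apply/eqP; rewrite eqn_leq xz andbT leqNgt; apply/negP.
  move=> lt_z; have [a ca aE] := gap _ _ cz lt_z; have := h a ca; rewrite /=.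
  by do 2 (rewrite sat_lt; [|lia..]); upd; rewrite !ltE // aE ltnSn => /(_ isT).
split=> [|a ca /=]; first by rewrite zx.
by do 2 (rewrite sat_lt; [|lia..]); upd; rewrite !ltE // zx; lia.
Qed.

End Numbering.

Opaque Fzero Fsucc.

(** * Formulas for the graphs of recursive functions *)

Fixpoint Fexns k m p :=
  if m is m'.+1 then Fexn k (Fexns k.+1 m' p) else p.

(** The arguments [xs] and the value [z] are variables less than [k]. For [Rprec] the relation [k]
    contains the pair of the first argument and [z], and each of its pairs is justified: either it
    consists of zero and a value of [f], or it arises by [g] from a pair of the relation whose first
    member is the preceding number. *)
Fixpoint Fgraph n (f : recfun n) k : n.-tuple nat -> nat -> formula :=
  match f in recfun n return n.-tuple nat -> nat -> formula with
  | Rzero _ => fun _ z => Fzero k z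
  | Rsucc => fun xs z => Fsucc k (thead xs) z
  | Rproj _ i => fun xs z => Feq (tnth xs i) z
  | Rcomp m _ f g => fun xs z =>
      Fexns k m (foldr Fand (Fgraph f (k + m) [tuple k + i | i < m] z)
        [seq Fgraph (g i) (k + m) xs (k + i) | i <- enum 'I_m])
  | Rprec n f g => fun xs z =>
      Fex k (Fand (Frel k.+1 k (thead xs) z)
        (Falln k.+1 (Falln k.+2 (Fimp (Frel k.+3 k k.+1 k.+2)
          (For
            (Fand (Fzero k.+3 k.+1) (Fgraph f k.+3 [tuple of behead xs] k.+2))
            (Fexn k.+3 (Fexn k.+4
              (Fand (Fsucc k.+4.+1 k.+3 k.+1)
                (Fand (Frel k.+4.+1 k k.+3 k.+4)
                   (Fgraph g k.+4.+1 [tuple of k.+3 :: k.+4 :: behead xs]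
                     k.+2))))))))))
  | Rmu n f => fun xs z =>
      Fand
        (Fexn k (Fand (Fzero k.+1 k) (Fgraph f k.+1 [tuple of z :: xs] k)))
        (Falln k (Fimp (Flt k.+1 k z)
          (Fexn k.+1 (Fand (Fneg (Fzero k.+2 k.+1))
            (Fgraph f k.+2 [tuple of k :: xs] k.+1)))))
  end.

Lemma closed_exns k m p :
  closed_below (k + m) p -> closed_below k (Fexns k m p).
Proof.
elim: m k => [|m IH] k /=; first by rewrite addn0.
by rewrite addnS -addSn => /IH; exact: closed_exn.
Qed.

Lemma closed_foldr (I : Type) k p (F : I -> formula) s : closed_below k p ->
  (forall i, closed_below k (F i)) ->
  closed_below k (foldr Fand p [seq F i | i <- s]).
Proof. by move=> kp kF; elim: s => //= i s IH; rewrite closed_and kF. Qed.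

Lemma closed_graph n (f : recfun n) k (xs : n.-tuple nat) z : (3 < k)%N ->
  (forall i, tnth xs i < k)%N -> (z < k)%N -> closed_below k (Fgraph f k xs z).
Proof.
elim: f k xs z => {n} [n||n i|m n f IHf g IHg|n f IHf g IHg|n f IHf] /=
  k xs z k3 xk zk.
- exact: closed_zero.
- by apply: closed_succ => //; exact: xk.
- by rewrite closed_eq zk xk.
- apply: closed_exns; apply: closed_foldr => [|i].
    apply: IHf => [|i|]; try lia.
    by rewrite tnth_mktuple; have := ltn_ord i; lia.
  have := ltn_ord i => im; apply: IHg => [|j|]; try lia.
  by have := xk j; lia.
- have x0 : (thead xs < k)%N by exact: xk.
  have bk i : (tnth [tuple of behead xs] i < k)%N by rewrite tnth_behead xk.
  apply: closed_ex; rewrite closed_and closed_rel /=; try lia.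
  do 2 apply: closed_alln; rewrite !closedE closed_rel; try lia.
  rewrite closed_zero ?IHf /=; try lia.
    do 2 apply: closed_exn; rewrite closed_and closed_succ /=; try lia.
    rewrite closed_and closed_rel /=; try lia.
    apply: IHg; try lia.
    move=> i; rewrite (tnth_nth 0); case: i => [[|[|i]]] //= ib; try lia.
    by have := bk (Ordinal (ib : i < n)%N); rewrite (tnth_nth 0) /=; lia.
  by move=> i; apply: leq_trans (bk i) _; lia.
- rewrite closed_and; apply/andP; split.
    apply: closed_exn; rewrite closed_and closed_zero ?IHf //; try lia.
    move=> i; rewrite (tnth_nth 0); case: i => [[|i]] //= ib; try lia.
    by have := xk (Ordinal (ib : i < n)%N); rewrite (tnth_nth 0) /=; lia.
  apply: closed_alln; rewrite closed_imp closed_lt /=; try lia.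
  apply: closed_exn; rewrite !closedE closed_zero ?IHf //; try lia.
  move=> i; rewrite (tnth_nth 0); case: i => [[|i]] //= ib; try lia.
  by have := xk (Ordinal (ib : i < n)%N); rewrite (tnth_nth 0) /=; lia.
Qed.

(** * Recursive functions *)

Section Graph.
Variables (d : Order.disp_t) (L : latticeType d).
Implicit Types (a b : L) (v : nat -> L) (val : L -> nat) (k x z : nat).

Lemma sat_fands (I : eqType) v p (F : I -> formula) (s : seq I) :
  satisfies v (foldr Fand p [seq F i | i <- s]) <->
  satisfies v p /\ forall i, i \in s -> satisfies v (F i).
Proof.
elim: s => [|i s IH] /=; first by split=> // -[].
rewrite IH; split=> [[Fi [pv Fs]]|[pv Fs]].
  by split=> // j; rewrite inE => /predU1P[->|/Fs].
split; first by apply: Fs; rewrite mem_head.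
by split=> // j js; apply: Fs; rewrite inE js orbT.
Qed.

Definition agree k v v' := forall j, (j < k)%N -> v' j = v j.

Lemma agree_update v k a : agree k v (update v k a).
Proof. by move=> j jk; rewrite update_other //; lia. Qed.

Lemma agree_trans v2 v1 v3 k k' : (k <= k')%N ->
  agree k v1 v2 -> agree k' v2 v3 -> agree k v1 v3.
Proof.
by move=> kk' a12 a23 j jk; rewrite a23 ?a12 //; exact: leq_trans kk'.
Qed.

Lemma sat_exns v k m p : (0 < k)%N -> satisfies v (Fexns k m p) ->
  exists2 v', agree k v v' &
    (forall j, j < m -> canonical_joinand (v 0) (v' (k + j)))%N /\
    satisfies v' p.
Proof.
elim: m k v => [|m IH] k v k0 /=; first by exists v.
rewrite sat_exn // => -[a ca] /IH[|v' vv'] //; upd => -[cv' pv'].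
exists v'; first by apply: agree_trans vv'; last exact: agree_update.
split=> // -[_|j jm]; last by rewrite addnS -addSn; exact: cv'.
by rewrite addn0 vv' //; upd.
Qed.

Lemma sat_exns_intro v k m p (ys : nat -> L) : (0 < k)%N ->
  (forall j, j < m -> canonical_joinand (v 0) (ys j))%N ->
  (forall v', agree k v v' -> (forall j, j < m -> v' (k + j)%N = ys j)%N ->
    satisfies v' p) ->
  satisfies v (Fexns k m p).
Proof.
elim: m k v ys => [|m IH] k v ys k0 cys pys /=; first exact: pys.
rewrite sat_exn //; exists (ys 0); first exact: cys.
apply: (IH _ _ (fun j => ys j.+1)) => // [j jm|v' vv' v'E].
  by upd; apply: cys.
apply: pys => [|[_|j jm]].
- by apply: agree_trans vv'; last exact: agree_update.
- by rewrite addn0 vv' //; upd.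
- by rewrite addnS -addSn v'E.
Qed.

Definition denotes val v k x n :=
  [/\ (x < k)%N, canonical_joinand (v 0) (v x) & val (v x) = n].

Lemma denotes_agree val v v' k k' x n : (0 < k)%N -> (k <= k')%N ->
  agree k v v' -> denotes val v k x n -> denotes val v' k' x n.
Proof.
move=> k0 kk' vv' [xk cx nE]; split; first exact: leq_trans kk'.
  by rewrite !vv'.
by rewrite vv'.
Qed.

Lemma denotes_update val v k a x n : (0 < k)%N ->
  denotes val v k x n -> denotes val (update v k a) k.+1 x n.
Proof. by move=> k0; apply: denotes_agree => //; exact: agree_update. Qed.

Lemma denotes_new val v k a : (0 < k)%N -> canonical_joinand (v 0) a ->
  denotes val (update v k a) k.+1 k (val a).
Proof. by move=> k0 ca; split=> //; upd. Qed.

Lemma numbering_agree val v v' k : (3 < k)%N -> agree k v v' ->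
  numbering v val -> numbering v' val.
Proof. by move=> k3 vv'; rewrite /numbering !vv' //; lia. Qed.

Lemma numbering_update val v k a : (3 < k)%N ->
  numbering v val -> numbering (update v k a) val.
Proof. by move=> k3; apply: numbering_agree k3 (@agree_update _ _ _). Qed.

Lemma denotes_cons n val v k x m (xs ns : n.-tuple nat) :
  denotes val v k x m ->
  (forall i, denotes val v k (tnth xs i) (tnth ns i)) ->
  forall i, denotes val v k (tnth [tuple of x :: xs] i)
    (tnth [tuple of m :: ns] i).
Proof.
by move=> dx ds i; case: (unliftP ord0 i) => [j|] ->; rewrite ?tnthS ?tnth0.
Qed.

Lemma denotes_behead n val v k (xs ns : n.+1.-tuple nat) :
  (forall i, denotes val v k (tnth xs i) (tnth ns i)) ->
  forall i, denotes val v k (tnth [tuple of behead xs] i)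
    (tnth [tuple of behead ns] i).
Proof. by move=> ds i; rewrite !tnth_behead. Qed.

(** By induction on [f]. For a primitive recursion the pairs of the relation are followed downwards
    from the given one; their first members decrease to zero, and the second members form a sequence
    of values. *)
Theorem graph_sound n (f : recfun n) val v k (xs ns : n.-tuple nat) z m :
  numbering v val -> (3 < k)%N ->
  (forall i, denotes val v k (tnth xs i) (tnth ns i)) ->
  denotes val v k z m -> satisfies v (Fgraph f k xs z) -> reval f ns m.
Proof.
elim: f v k xs ns z m => {n}
  [n||n i|m' n f IHf g IHg|n f IHf g IHg|n f IHf] v k xs ns z m num k3 dxs dz.
- by case: dz => zk cz <-; rewrite /= (sat_zero num).
- have [xk cx xE] := dxs ord0; case: dz => zk cz <-.
  by rewrite /= (sat_succ num) // xE.
- by have [_ _ /= <-] := dxs i; case: dz => _ _ /= <- ->.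
- rewrite /=; move=> /sat_exns[|v' vv' [cv']]; first lia.
  move=> /sat_fands[fv' gv'].
  have ds i : denotes val v' (k + m') (tnth [tuple k + i | i < m'] i)
      (tnth [tuple val (v' (k + i)) | i < m'] i).
    have im := ltn_ord i; rewrite !tnth_mktuple; split=> //; first by lia.
    by rewrite (vv' 0); [exact: cv'|lia].
  have num' := numbering_agree k3 vv' num.
  exists [tuple val (v' (k + i)) | i < m']; split=> [i|].
    apply: (IHg i v' (k + m') xs ns (k + i)) => //; try lia.
    + move=> j; apply: denotes_agree vv' (dxs j); lia.
    + by have := ds i; rewrite tnth_mktuple.
    + by apply: gv'; rewrite mem_enum.
  apply: IHf fv'; rewrite ?ds //; try lia.
  by apply: denotes_agree vv' dz; lia.
- have [x0k cx0 x0E] : denotes val v k (thead xs) (thead ns) := dxs ord0.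
  have [zk cz zE] := dz.
  rewrite /= => -[r []]; rewrite sat_rel; [upd => rxz|lia..].
  rewrite sat_alln; last lia; upd => h.
  (* What the formula says about a pair of [r], with the induction hypotheses for [f] and [g]
     already applied. *)
  have {h} step a b : canonical_joinand (v 0) a -> canonical_joinand (v 0) b ->
      related (v 1) (v 2) r a b ->
      (val a = 0 /\ reval f [tuple of behead ns] (val b)) \/
      exists a' b', [/\ canonical_joinand (v 0) a', canonical_joinand (v 0) b',
        val a = (val a').+1, related (v 1) (v 2) r a' b' &
        reval g [tuple of val a' :: val b' :: behead ns] (val b)].
    move=> ca cb rab; have := h a ca; rewrite sat_alln; last lia; upd.
    move=> /(_ b cb) /=; rewrite sat_rel; try lia; upd => /(_ rab) {h rab}.
    pose v1 := update v k r; pose v2 := update v1 k.+1 a.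
    pose v3 := update v2 k.+2 b.
    have num3 : numbering v3 val.
      by do 3 (apply: numbering_update; [lia|]).
    have ds3 i : denotes val v3 k.+3 (tnth [tuple of behead xs] i)
        (tnth [tuple of behead ns] i).
      by do 3 (apply: denotes_update; [lia|]); exact: denotes_behead.
    have da3 : denotes val v3 k.+3 k.+1 (val a).
      apply: denotes_update => //; apply: denotes_new => //.
      by rewrite /v1; upd.
    have db3 : denotes val v3 k.+3 k.+2 (val b).
      by apply: denotes_new => //; rewrite /v2 /v1; upd.
    case=> [|].
      rewrite (sat_zero num3); [|lia..|by rewrite /v3 /v2 /v1; upd].
      rewrite /v3 /v2 /v1; upd => -[a0 fb].
      by left; split=> //; apply: IHf ds3 db3 fb => //; lia.
    rewrite sat_exn; last lia; upd => -[a' ca']; rewrite sat_exn; last lia; upd.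
    move=> [b' cb'] /=; set v4 := update _ k.+3 a'; set v5 := update _ k.+4 b'.
    have num5 : numbering v5 val.
      by do 2 (apply: numbering_update; [lia|]).
    rewrite (sat_succ num5);
      [|lia..|by rewrite /v5 /v4; upd|by rewrite /v5 /v4; upd].
    rewrite sat_rel; [|lia..]; rewrite {1 2 3 4 5 6 7}/v5 /v4; upd.
    move=> [aE [r' gb]]; right; exists a', b'; split=> //.
    apply: IHg gb => //; try lia.
    + apply: denotes_cons; last apply: denotes_cons.
      * apply: denotes_update; first lia.
        by apply: denotes_new => //; upd.
      * by apply: denotes_new => //; rewrite /v4; upd.
      * by move=> i; do 2 (apply: denotes_update; [lia|]).
    + by do 2 (apply: denotes_update; [lia|]).
  suff H l a b : val a = l -> canonical_joinand (v 0) a ->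
      canonical_joinand (v 0) b -> related (v 1) (v 2) r a b ->
      prec_graph (reval f [tuple of behead ns])
        (fun k y => reval g [tuple of k :: y :: behead ns]) l (val b).
    by rewrite -zE; apply: H rxz => //.
  elim: l a b => [|l IH] a b aE ca cb rab /=.
    by have [[]//|[a' [b' []]]] := step a b ca cb rab; rewrite aE.
  have [[]|[a' [b' [ca' cb' aE' rab' gb]]]] := step a b ca cb rab.
    by rewrite aE.
  move: aE'; rewrite aE => -[lE]; exists (val b'); rewrite lE; split=> //.
  by rewrite -lE; apply: IH rab'.
- have [zk cz zE] := dz.
  rewrite /= => -[]; rewrite sat_exn; last lia.
  move=> [o co] /=; have num1 a : numbering (update v k a) val.
    by apply: numbering_update.
  rewrite (sat_zero (num1 o)); [upd|lia..|by upd] => -[o0 fz].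
  rewrite sat_alln; last lia; move=> h; split.
    apply: IHf fz => //; [lia| |by rewrite -o0; apply: denotes_new => //; lia].
    by apply: denotes_cons => [|i]; apply: denotes_update => //; lia.
  move=> l lm; have [_ _ gap] := num.
  (* The numbering has no gap below the value of [z], so some number has the value [l]. *)
  have [a ca aE] : exists2 a, canonical_joinand (v 0) a & val a = l.
    by apply: gap cz _; rewrite zE.
  have [_ ltE _] := num.
  have := h a ca; rewrite /= sat_lt; [|lia..]; upd; rewrite ltE // aE zE lm.
  move=> /(_ isT); rewrite sat_exn; last lia; upd => -[b cb] /=.
  have num2 : numbering (update (update v k a) k.+1 b) val.
    by apply: numbering_update; [lia|].
  rewrite (sat_zero num2); [upd|lia..|by upd] => -[/eqP b0 fb].
  (* The value of [b] is positive and has to be presented as a successor. *)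
  exists (val b).-1; apply: IHf fb => //; try lia.
    apply: denotes_cons => [|i]; last by do 2 (apply: denotes_update; [lia|]).
    by rewrite -aE; apply: denotes_update; [lia|apply: denotes_new => //; lia].
  rewrite prednK; last by rewrite lt0n.
  by apply: denotes_new; [lia|upd].
Qed.

(** * Description of halting computations *)

Definition rich v val K : Prop :=
  [/\ numbering v val,
      forall n, (n <= K)%N ->
        exists2 a, canonical_joinand (v 0) a & val a = n
    & forall R : seq (nat * nat), exists r, forall a b,
        canonical_joinand (v 0) a -> canonical_joinand (v 0) b ->
        related (v 1) (v 2) r a b <-> (val a, val b) \in R].

Lemma rich_agree v v' val k K : (3 < k)%N -> agree k v v' ->
  rich v val K -> rich v' val K.
Proof.
move=> k3 vv' [num nums rels].
have e j : (j <= 2)%N -> v' j = v j by move=> j2; apply: vv'; lia.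
by split; [exact: numbering_agree vv' num|rewrite !e..].
Qed.

Lemma rich_update v val k K a : (3 < k)%N ->
  rich v val K -> rich (update v k a) val K.
Proof. by move=> k3; apply: rich_agree k3 (@agree_update _ _ _). Qed.

Lemma richW v val K K' : (K <= K')%N -> rich v val K' -> rich v val K.
Proof.
by move=> KK' [num nums rels]; split=> // n /leq_trans /(_ KK') /nums.
Qed.

Definition graph_holds n (f : recfun n) (ns : n.-tuple nat) m K : Prop :=
  forall v val k (xs : n.-tuple nat) z, rich v val K -> (3 < k)%N ->
    (forall i, denotes val v k (tnth xs i) (tnth ns i)) ->
    denotes val v k z m -> satisfies v (Fgraph f k xs z).

Lemma graph_holdsW n (f : recfun n) ns m K K' : (K <= K')%N ->
  graph_holds f ns m K -> graph_holds f ns m K'.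
Proof. by move=> KK' h v val k xs z /(richW KK') rv; exact: h. Qed.

Lemma common_bound m (P : nat -> nat -> Prop) :
  (forall j K K', (K <= K')%N -> P j K -> P j K') ->
  (forall j, (j < m)%N -> exists K, P j K) ->
  exists K, forall j, (j < m)%N -> P j K.
Proof.
move=> Pmono; elim: m => [|m IH] Pm; first by exists 0.
have [|K PK] := IH; first by move=> j jm; apply: Pm; exact: ltnW.
have [K' PK'] := Pm m (ltnSn m).
exists (maxn K K') => j; rewrite ltnS leq_eqVlt => /orP[/eqP->|/PK].
  by apply: Pmono PK'; exact: leq_maxr.
by apply: Pmono; exact: leq_maxl.
Qed.

Lemma prec_graph_sequence (F : nat -> Prop) (H : nat -> nat -> nat -> Prop)
    n m :
  prec_graph F H n m -> exists ys : nat -> nat,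
    [/\ F (ys 0), forall j, (j < n)%N -> H j (ys j) (ys j.+1) & ys n = m].
Proof.
elim: n m => [|n IH] m /=; first by exists (fun=> m).
move=> [l [/IH[ys [F0 Hj ynl]] Hlm]].
exists (fun j => if j == n.+1 then m else ys j); rewrite eqxx; split=> // j jn.
rewrite eqSS; case: (eqVneq j n) => [->|jn']; first by rewrite ltn_eqF // ynl.
by rewrite ltn_eqF //; apply: Hj; lia.
Qed.

(** A halting computation involves finitely many numbers, and [K] bounds them all. The relation for
    a primitive recursion encodes its sequence of values up to the first argument. *)
Theorem graph_complete n (f : recfun n) (ns : n.-tuple nat) m :
  reval f ns m -> exists K, graph_holds f ns m K.
Proof.
elim: f ns m => {n}
  [n||n i|m' n f IHf g IHg|n f IHf g IHg|n f IHf] ns m /=.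
- move=> ->; exists 0 => v val k xs z [num _ _] k3 _ [zk cz zE] /=.
  by rewrite (sat_zero num).
- move=> ->; exists 0 => v val k xs z [num _ _] k3 dxs [zk cz zE] /=.
  have [xk cx xE] : denotes val v k (thead xs) (thead ns) := dxs ord0.
  by rewrite (sat_succ num) // xE.
- move=> ->; exists 0 => v val k xs z [[inj _ _] _ _] k3 dxs [zk cz zE] /=.
  by have [xk cx xE] := dxs i; apply: inj => //; rewrite zE.
- move=> [ys [gys /IHf[K fK]]].
  (* The bound has to cover the intermediate values as well, since numbers denoting them must
     exist. *)
  have [j l l' ll' h jm|j jm|K' gK] := @common_bound m' (fun j l =>
      forall jm : (j < m')%N, let i := Ordinal jm in
      (tnth ys i <= l)%N /\ graph_holds (g i) ns (tnth ys i) l).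
  + have [h1 h2] := h jm; split.
      exact: leq_trans ll'.
    exact: graph_holdsW h2.
  + have [l gl] := IHg _ _ _ (gys (Ordinal jm)).
    exists (maxn l (tnth ys (Ordinal jm))) => jm'.
    rewrite (bool_irrelevance jm' jm); split; first exact: leq_maxr.
    by apply: graph_holdsW gl; exact: leq_maxl.
  exists (maxn K K') => v val k xs z rv k3 dxs dz /=.
  have [num nums _] := richW (leq_maxr K K') rv.
  have [j|a aP] := @boolp.choice _ _ (fun j b => (j < m')%N ->
      canonical_joinand (v 0) b /\ val b = nth 0 ys j).
    (* [v 0] is a default for the indices beyond the arity. *)
    case: (ltnP j m') => jm; last by exists (v 0).
    have [yK' _] := gK j jm jm; have [b cb bE] := nums _ yK'.
    by exists b; rewrite bE (tnth_nth 0).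
  apply: (sat_exns_intro (ys := a)) => [|j jm|v' vv' v'E]; first lia.
    by have [] := aP j jm.
  have rv' := rich_agree k3 vv' rv.
  have da (i : 'I_m') : denotes val v' (k + m') (k + i) (tnth ys i).
    have im := ltn_ord i; have [ca aE] := aP i im.
    by split; rewrite ?v'E ?aE ?(vv' 0) ?(tnth_nth 0) //; lia.
  apply/sat_fands; split=> [|i _].
    apply: (fK v' val) => //; first exact: richW (leq_maxl _ _) rv'.
    + by lia.
    + by move=> i; rewrite tnth_mktuple.
    + by apply: denotes_agree vv' dz; lia.
  have im := ltn_ord i; have [_] := gK i im im.
  rewrite (_ : Ordinal im = i); last exact: val_inj.
  move=> /(_ v' val (k + m')) h; apply: h => //.
  + exact: richW (leq_maxr _ _) rv'.
  + by lia.
  + by move=> j; apply: denotes_agree vv' (dxs j); lia.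
- move=> /prec_graph_sequence[ys [/IHf[K fK] gys yE]].
  have [j l l' ll' [h1 h2]|j jn|K' gK] :=
    @common_bound (thead ns).+1 (fun j l =>
      (maxn j (ys j) <= l)%N /\ ((j < thead ns)%N ->
        graph_holds g [tuple of j :: ys j :: behead ns] (ys j.+1) l)).
  + split; first exact: leq_trans ll'.
    by move=> /h2; exact: graph_holdsW.
  + have [jn'|jn'] := ltnP j (thead ns); last by exists (maxn j (ys j)).
    have [l gl] := IHg _ _ (gys j jn'); exists (maxn l (maxn j (ys j))).
    by split=> [|_]; [exact: leq_maxr|apply: graph_holdsW gl; exact: leq_maxl].
  exists (maxn K K') => v val k xs z rv k3 dxs dz /=.
  have [x0k cx0 x0E] : denotes val v k (thead xs) (thead ns) := dxs ord0.
  have [zk cz zE] := dz.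
  have [num nums rels] := richW (leq_maxr K K') rv.
  have [r rP] := rels [seq (j, ys j) | j <- iota 0 (thead ns).+1].
  have {rP} rP a b : canonical_joinand (v 0) a -> canonical_joinand (v 0) b ->
      related (v 1) (v 2) r a b <->
      (val a <= thead ns)%N /\ val b = ys (val a).
    move=> ca cb; rewrite rP //; split=> [/mapP[j]|[an bE]].
      by rewrite mem_iota add0n ltnS => jn [-> ->].
    by apply/mapP; exists (val a); rewrite ?bE // mem_iota.
  exists r; rewrite sat_rel; [upd|lia..]; split.
    by rewrite rP // x0E zE yE.
  rewrite sat_alln; last lia; upd => a ca; rewrite sat_alln; last lia; upd.
  move=> b cb /=; rewrite sat_rel; [upd|lia..]; rewrite rP // => -[an bE].
  set v1 := update v k r; set v2 := update v1 k.+1 a.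
  set v3 := update v2 k.+2 b.
  have rv3 : rich v3 val (maxn K K').
    by do 3 (apply: rich_update; [lia|]).
  have ds3 i : denotes val v3 k.+3 (tnth [tuple of behead xs] i)
      (tnth [tuple of behead ns] i).
    by do 3 (apply: denotes_update; [lia|]); exact: denotes_behead.
  have da3 : denotes val v3 k.+3 k.+1 (val a).
    by apply: denotes_update => //; apply: denotes_new => //; rewrite /v1; upd.
  have db3 : denotes val v3 k.+3 k.+2 (val b).
    by apply: denotes_new => //; rewrite /v2 /v1; upd.
  case aE : (val a) => [|j].
    left; split.
      have [num3 _ _] := rv3.
      by rewrite (sat_zero num3); [|lia..|]; rewrite /v3 /v2 /v1; upd.
    apply: (fK v3 val) ds3 _; [exact: richW (leq_maxl _ _) rv3|lia|].
    by rewrite aE in bE; rewrite -bE.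
  right; rewrite sat_exn; last lia.
  have jn : (j < thead ns)%N by rewrite -aE.
  have [jK' /(_ jn) gj] := gK j (ltnW jn).
  have [a' ca' aE'] := nums j (leq_trans (leq_maxl _ _) jK').
  have [b' cb' bE'] := nums (ys j) (leq_trans (leq_maxr _ _) jK').
  exists a'; first by rewrite /v3 /v2 /v1; upd.
  rewrite sat_exn; last lia; exists b'; first by rewrite /v3 /v2 /v1; upd.
  set v4 := update v3 k.+3 a'; set v5 := update v4 k.+4 b'.
  have rv5 : rich v5 val (maxn K K').
    by do 2 (apply: rich_update; [lia|]).
  have [num5 _ _] := rv5; split.
    rewrite (sat_succ num5); [|lia..|by rewrite /v5 /v4 /v3 /v2 /v1; upd
      |by rewrite /v5 /v4 /v3 /v2 /v1; upd].
    by rewrite /v5 /v4 /v3 /v2 /v1; upd; rewrite aE aE'.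
  split.
    rewrite sat_rel; [|lia..]; rewrite /v5 /v4 /v3 /v2 /v1; upd.
    by rewrite rP // aE' bE' (ltnW jn).
  apply: (gj v5 val); [exact: richW (leq_maxr _ _) rv5|lia| |].
  + apply: denotes_cons; last apply: denotes_cons.
    * rewrite -aE'; apply: denotes_update; first lia.
      by apply: denotes_new => //; rewrite /v3 /v2 /v1; upd.
    * by rewrite -bE'; apply: denotes_new => //; rewrite /v4 /v3 /v2 /v1; upd.
    * by move=> i; do 2 (apply: denotes_update; [lia|]).
  + by do 2 (apply: denotes_update; [lia|]); rewrite aE in bE; rewrite -bE.
- move=> [/IHf[K fK] fS].
  have [j l l' ll' [y [h1 h2]]|j /fS[y /IHf[l fl]]|K' fK'] :=
      @common_bound m (fun j l => exists y, (y < l)%N /\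
        graph_holds f [tuple of j :: ns] y.+1 l).
  + by exists y; split; [exact: leq_trans ll'|exact: graph_holdsW h2].
  + exists (maxn l y.+1), y; split; first exact: leq_maxr.
    by apply: graph_holdsW fl; exact: leq_maxl.
  exists (maxn K K') => v val k xs z rv k3 dxs dz /=.
  have [num nums rels] := rv; have [zk cz zE] := dz.
  have rv1 a : rich (update v k a) val (maxn K K') by exact: rich_update.
  split.
    rewrite sat_exn; last lia; have [o co oE] := nums 0 (leq0n _).
    have [num1 _ _] := rv1 o; exists o => //=; split.
      by rewrite (sat_zero num1); [upd|lia..|upd].
    apply: (fK _ val); [exact: richW (leq_maxl _ _) (rv1 o)|lia| |].
      by apply: denotes_cons => [|i]; apply: denotes_update => //; lia.
    by rewrite -oE; apply: denotes_new => //; lia.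
  rewrite sat_alln; last lia; move=> a ca /=; rewrite sat_lt; [|lia..]; upd.
  have [_ ltE _] := num; rewrite ltE // zE => am.
  have [y [yK' fy]] := fK' _ am.
  rewrite sat_exn; last lia; upd.
  have [b cb bE] := nums y.+1 (leq_trans yK' (leq_maxr _ _)).
  exists b => //=.
  have rv2 : rich (update (update v k a) k.+1 b) val (maxn K K').
    by apply: rich_update; [lia|].
  have [num2 _ _] := rv2; split.
    by rewrite (sat_zero num2); [upd; rewrite bE|lia..|upd].
  apply: (fy _ val); [exact: richW (leq_maxr _ _) rv2|lia| |].
    apply: denotes_cons => [|i]; last by do 2 (apply: denotes_update; [lia|]).
    by apply: denotes_update; [lia|apply: denotes_new => //; lia].
  by rewrite -bE; apply: denotes_new; [lia|upd].
Qed.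

End Graph.

(** * Computable functions and codes of formulas *)

Lemma reval_functional n (f : recfun n) xs y z :
  reval f xs y -> reval f xs z -> y = z.
Proof.
elim: f xs y z => {n}
  [n||n i|m n f IHf g IHg|n f IHf g IHg|n f IHf] xs y z /=.
- by move=> -> ->.
- by move=> -> ->.
- by move=> -> ->.
- move=> [us [gu fu]] [vs [gv fv]]; suff e : us = vs.
    by rewrite e in fu; exact: IHf fu fv.
  by apply: eq_from_tnth => i; exact: IHg (gu i) (gv i).
- elim: (thead xs) y z => [|k IHk] y z /=; first exact: IHf.
  by move=> [u [ku gu]] [u' [ku' gu']]; rewrite (IHk _ _ ku ku') in gu;
    exact: IHg gu gu'.
- move=> [fy ylt] [fz zlt]; case: (ltngtP y z) => // [/zlt|/ylt] [u fu].
    by have := IHf _ _ _ fy fu.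
  by have := IHf _ _ _ fz fu.
Qed.

Definition computable n (F : n.-tuple nat -> nat) : Prop :=
  exists f : recfun n, forall xs, reval f xs (F xs).

Lemma eq_computable n (F G : n.-tuple nat -> nat) :
  F =1 G -> computable F -> computable G.
Proof. by move=> FG [f fP]; exists f => xs; rewrite -FG. Qed.

Lemma computable_proj n i : computable (fun xs : n.-tuple nat => tnth xs i).
Proof. by exists (Rproj i). Qed.

Lemma computable_comp n m (G : m.-tuple nat -> nat)
    (F : 'I_m -> n.-tuple nat -> nat) :
  computable G -> (forall i, computable (F i)) ->
  computable (fun xs => G [tuple F i xs | i < m]).
Proof.
move=> [g gP] /boolp.choice[f fP]; exists (Rcomp g f) => xs /=.
by exists [tuple F i xs | i < m]; split=> // i; rewrite tnth_mktuple.
Qed.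

Lemma computable_succ n (F : n.-tuple nat -> nat) :
  computable F -> computable (fun xs => (F xs).+1).
Proof.
move=> [f fP]; exists (Rcomp Rsucc (fun=> f)) => xs /=.
exists [tuple F xs]; split=> // i; rewrite (ord1 i); exact: fP.
Qed.

Lemma computable_const n c : computable (fun _ : n.-tuple nat => c).
Proof.
elim: c => [|c IH]; first by exists (Rzero n).
exact: computable_succ.
Qed.

Lemma computable_rec n (F : n.-tuple nat -> nat) (G : n.+2.-tuple nat -> nat) :
  computable F -> computable G ->
  computable (fun xs : n.+1.-tuple nat =>
    nat_rec (fun=> nat) (F [tuple of behead xs])
      (fun k y => G [tuple of k :: y :: behead xs]) (thead xs)).
Proof.
move=> [f fP] [g gP]; exists (Rprec f g) => xs /=.
elim: (thead xs) => [|k IH] /=; first exact: fP.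
by eexists; split; [exact: IH|exact: gP].
Qed.

Definition computable2 (G : nat -> nat -> nat) : Prop :=
  computable (fun xs : 2.-tuple nat => G (tnth xs ord0) (tnth xs ord_max)).

Lemma computable_comp2 n G (F1 F2 : n.-tuple nat -> nat) :
  computable2 G -> computable F1 -> computable F2 ->
  computable (fun xs => G (F1 xs) (F2 xs)).
Proof.
move=> cG c1 c2.
have := computable_comp (F := fun i : 'I_2 => if i == ord0 then F1 else F2) cG.
case=> [i|f fP]; first by case: ifP.
by exists f => xs; have := fP xs; rewrite !tnth_mktuple.
Qed.

Lemma computable_add : computable2 addn.
Proof.
apply: eq_computable (computable_rec (computable_proj (n := 1) ord0)
  (computable_succ (computable_proj (n := 3) (lift ord0 ord0)))) => xs.
rewrite tnth_behead -[tnth xs ord0]/(thead xs).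
rewrite (_ : inord 1 = ord_max); last by apply: val_inj; rewrite /= inordK.
by elim: (thead xs) => // k IH; rewrite addSn -IH.
Qed.

Lemma computable_pair : computable2 pair_code.
Proof.
(* Triangular numbers: Cantor's code of [(x, y)] is [y + tri (y + x)]. *)
pose tri := nat_rec (fun=> nat) 0 (fun i m => i.+1 + m)%N.
have ctri : computable (fun xs : 1.-tuple nat => tri (tnth xs ord0)).
  apply: eq_computable (computable_rec (computable_const 0 0)
    (computable_comp2 computable_add
      (computable_succ (computable_proj (n := 2) ord0))
      (computable_proj (n := 2) ord_max))) => xs.
  exact: erefl.
have csum := computable_comp2 computable_add
  (computable_proj (n := 2) ord_max) (computable_proj (n := 2) ord0).
apply: eq_computable (computable_comp2 computable_add
  (computable_proj (n := 2) ord_max)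
  (computable_comp ctri (fun _ : 'I_1 => csum))) => xs.
by rewrite tnth_mktuple.
Qed.

Lemma computable_pair_const n c (F : n.-tuple nat -> nat) :
  computable F -> computable (fun xs => pair_code c (F xs)).
Proof.
by move=> cF; apply: computable_comp2 computable_pair _ cF;
  exact: computable_const.
Qed.

(* Requantifying the variable 4 keeps the variables of all numerals below a
   fixed bound. *)
Fixpoint Fnumeral n :=
  if n is n'.+1 then
    Fexn 5 (Fand (Fsucc 6 5 4) (Fex 4 (Fand (Feq 4 5) (Fnumeral n'))))
  else Fzero 5 4.

Lemma closed_numeral n : closed_below 5 (Fnumeral n).
Proof.
elim: n => [|n IH]; first exact: closed_zero.
apply: closed_exn; rewrite closed_and closed_succ //=.
have : closed_below 6 (Fand (Feq 4 5) (Fnumeral n)).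
  by rewrite closed_and closed_eq /=; exact: closed_belowW IH.
by move=> /allP c6; apply/allP => y; rewrite mem_filter => /andP[_ /c6].
Qed.

Lemma sat_numeral d (L : latticeType d) (v : nat -> L) val n :
  numbering v val -> canonical_joinand (v 0) (v 4) ->
  satisfies v (Fnumeral n) <-> val (v 4) = n.
Proof.
elim: n v => [|n IH] v num c4 /=; first by rewrite (sat_zero num).
have [_ _ gap] := num.
have num5 a : numbering (update v 5 a) val by exact: numbering_update.
have step a : canonical_joinand (v 0) a ->
    satisfies (update v 5 a)
      (Fand (Fsucc 6 5 4) (Fex 4 (Fand (Feq 4 5) (Fnumeral n)))) <->
    val (v 4) = (val a).+1 /\ val a = n.
  move=> ca; rewrite /= (sat_succ (num5 a)) //; upd => //.
  have eqn : satisfies (update (update v 5 a) 4 a) (Fnumeral n) <-> val a = n.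
    by rewrite IH; upd => //; exact: numbering_update.
  split=> [[-> [b []]]|[-> /eqn an]]; upd.
    by move=> -> /eqn.
  by split=> //; exists a; upd.
rewrite sat_exn //; split=> [[a ca /(step a ca)[-> ->]] //|v4].
have [|a ca an] := gap _ n c4; first by rewrite v4.
by exists a => //; apply/step; rewrite // v4 an.
Qed.

(** In place of a substitution of [m] for the variable 4 there is a quantifier over the numbers of
    value [m], so coding the instance takes only pairings and the code of a numeral. With [m] the
    code of [phi] this is the diagonal construction. *)
Definition Finstance m phi :=
  Fall 0 (Fall 1 (Fall 2 (Fall 3 (Fimp Forder
    (Falln 4 (Fimp (Fnumeral m) phi)))))).

Definition instance_code m c :=
  pair_code 6 (pair_code 0 (pair_code 6 (pair_code 1 (pair_code 6 (pair_code 2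
    (pair_code 6 (pair_code 3 (pair_code 5 (pair_code (godel Forder)
      (pair_code 6 (pair_code 4 (pair_code 5 (pair_code (godel (Fnum 5 4))
        (pair_code 5 (pair_code (godel (Fnumeral m)) c))))))))))))))).

Lemma godel_instance m phi :
  godel (Finstance m phi) = instance_code m (godel phi).
Proof. exact: erefl. Qed.

Lemma sentence_instance m phi :
  closed_below 5 phi -> sentence (Finstance m phi).
Proof.
move=> c5; suff : closed_below 0 (Finstance m phi).
  by rewrite /closed_below /sentence; case: free_vars.
do 4 apply: closed_all; rewrite closed_imp closed_order.
by apply: closed_alln; rewrite closed_imp closed_numeral.
Qed.

Lemma update_id (T : Type) (v : nat -> T) k : update v k (v k) = v.
Proof. by apply: funext => j; rewrite /update; case: eqVneq => [->|]. Qed.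

Lemma true_in_instance d (L : latticeType d) m phi :
  true_in L (Finstance m phi) <->
  forall v : nat -> L, strict_order v ->
  forall a, canonical_joinand (v 0) a ->
    satisfies (update v 4 a) (Fnumeral m) -> satisfies (update v 4 a) phi.
Proof.
have E v : satisfies v (Fimp Forder (Falln 4 (Fimp (Fnumeral m) phi))) <->
    (strict_order v -> forall a, canonical_joinand (v 0) a ->
      satisfies (update v 4 a) (Fnumeral m) -> satisfies (update v 4 a) phi).
  rewrite -sat_order.
  suff -> : satisfies v (Fimp Forder (Falln 4 (Fimp (Fnumeral m) phi))) =
    (satisfies v Forder -> satisfies v (Falln 4 (Fimp (Fnumeral m) phi))).
    by rewrite sat_alln.
  exact: erefl.
split=> [H v|H v a b c r]; last exact/E/H.
by apply/E; have := H v (v 0) (v 1) (v 2) (v 3); rewrite !update_id.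
Qed.

(** The same function [step] leads from the code of each numeral to that of the next, so the codes
    obey a primitive recursion. *)
Lemma computable_numeral :
  computable (fun xs : 1.-tuple nat => godel (Fnumeral (tnth xs ord0))).
Proof.
pose step c := pair_code 7 (pair_code 5 (pair_code 3
  (pair_code (godel (Fnum 6 5)) (pair_code 3
    (pair_code (godel (Fsucc 6 5 4)) (pair_code 7 (pair_code 4 (pair_code 3
      (pair_code (godel (Feq 4 5)) c))))))))).
have cstep : computable (fun xs : 2.-tuple nat => step (tnth xs ord_max)).
  by do 10 apply: computable_pair_const; exact: computable_proj.
apply: eq_computable
  (computable_rec (computable_const 0 (godel (Fnumeral 0))) cstep) => xs.
rewrite -[tnth xs ord0]/(thead xs); elim: (thead xs) => [|k IH].
  exact: erefl.
transitivity (step (godel (Fnumeral k))); last exact: erefl.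
by rewrite -IH.
Qed.

Lemma computable_instance :
  exists f : recfun 1, forall c, reval f [tuple c] (instance_code c c).
Proof.
suff [f fP] : computable (fun xs : 1.-tuple nat =>
    instance_code (tnth xs ord0) (tnth xs ord0)).
  by exists f => c; exact: (fP [tuple c]).
rewrite /instance_code; do 15 apply: computable_pair_const.
apply: computable_comp2 computable_pair computable_numeral _.
exact: computable_proj.
Qed.

(** * Rich assignments in free lattices *)

Section RichModel.
Variables (X : Type) (d : Order.disp_t) (L : latticeType d) (i : X -> L).
Hypothesis free_i : free_lattice_on i.

Lemma free_rich (e : 'I_3 -> X) K : injective e ->
  exists (v : nat -> L) (val : L -> nat), rich v val K.
Proof.
move=> e_inj; pose G a := exists x, a = i x.
pose g (j : 'I_3) := i (e j).
have Gg j : G (g j) by exists (e j).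
have whitman := free_whitman free_i.
have jp a : G a -> forall b b', a <= b `|` b' -> a <= b \/ a <= b'.
  by move=> [x ->]; exact: free_gen_join_prime.
have mp a : G a -> forall b b', b `&` b' <= a -> b <= a \/ b' <= a.
  by move=> [x ->]; exact: free_gen_meet_prime.
have ac a b : G a -> G b -> a <= b -> a = b.
  by move=> [x ->] [y ->] /(free_gen_le free_i) ->.
have g_inj j j' : g j = g j' -> j = j'.
  move=> gjj'; apply: e_inj; apply: (free_gen_le free_i).
  by rewrite -/(g j) gjj'.
pose x := g ord0; pose y := g (lift ord0 ord0); pose z := g ord_max.
have xy : x <> y by move/g_inj.
have yz : y <> z by move/g_inj.
have zx : z <> x by move/g_inj.
have Gx : G x := Gg _; have Gy : G y := Gg _; have Gz : G z := Gg _.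
pose nu := num x y z; pose r := relation_code x y z.
have relP := relation_codeP whitman jp mp ac Gx Gy Gz xy yz zx.
have lineP := line_joinandP whitman jp mp ac Gx Gy Gz xy yz zx.
have nu_inj m n : nu m = nu n -> m = n.
  move=> mn; have : nu m <= nu n by rewrite mn.
  by move/(pt_inj whitman jp mp ac Gx Gy Gz xy yz zx) => -[].
(* [val] inverts [nu]; at other elements any value will do, and 0 is offered. *)
have [a|val valP] := @boolp.choice _ _ (fun a n => forall m, a = nu m -> n = m).
  have [[n ->]|na] := pselect (exists n, a = nu n).
    by exists n => m /nu_inj.
  by exists 0 => m am; case: na; exists m.
have valE n : val (nu n) = n by exact: valP.
(* The order of the numbers up to [K], to be encoded by the parameter 3. *)
pose R := [seq p <- [seq (m, n) | m <- iota 0 K.+1, n <- iota 0 K.+1] |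
  p.1 < p.2]%N.
have RE m n : (m <= K)%N -> (n <= K)%N -> ((m, n) \in R) = (m < n)%N.
  move=> mK nK; rewrite mem_filter; apply: andb_idr => _.
  by apply/allpairsP; exists (m, n); rewrite !mem_iota.
(* The list holds the parameters 0, 1 and 2; the default [r R] becomes the value of the parameter 3
   and of all later variables. *)
exists (nth (r R) [:: line x y z K; pt x y z 0; pt x y z 1]), val; split.
- split=> /= [a b /lineP[m mK ->] /lineP[n nK ->]
    |a b /lineP[m mK ->] /lineP[n nK ->]|a n /lineP[m mK ->]].
  + by rewrite !valE => ->.
  + by rewrite !valE -RE //; apply/idP/idP => /relP.
  + rewrite valE => nm; exists (nu n); last exact: valE.
    by apply/lineP; exists n => //; lia.
- by move=> n nK; exists (nu n); [apply/lineP; exists n|exact: valE].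
- move=> S; exists (r S) => a b /lineP[m mK ->] /lineP[n nK ->].
  by rewrite !valE; exact: relP.
Qed.

End RichModel.

(** Let [S] say that [f] takes no value but 0 at the code of [S]. If [S] is in the theory, the
    computation with value 1 is described in the free lattice where the theory holds, against [S].
    Otherwise [f] takes the value 0 only, so [S] holds in every free lattice by soundness, against
    [refute]. *)
Lemma undecidable_free (Th : formula -> Prop) :
  (forall phi, sentence phi -> ~ Th phi ->
    exists (d : Order.disp_t) (L : latticeType d),
      free_lattice L /\ ~ true_in L phi) ->
  (exists (d : Order.disp_t) (L : latticeType d) (X : Type) (i : X -> L)
      (e : 'I_3 -> X),
    [/\ free_lattice_on i, injective e &
      forall phi, Th phi -> true_in L phi]) ->
  undecidable_theory Th.
Proof.
move=> refute [d [L [X [i [e [free_i e_inj sound]]]]]] [f fP].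
have [s sP] := computable_instance.
(* From the code of a formula, [h] computes the verdict of [f] on the instance of that formula at
   its own code. *)
have [h hE] : exists h : recfun 1, forall phi z,
    reval f [tuple godel (Finstance (godel phi) phi)] z ->
    reval h [tuple godel phi] z.
  exists (Rcomp f (fun=> s)) => phi z fz.
  exists [tuple godel (Finstance (godel phi) phi)]; split; last exact: fz.
  by move=> j; rewrite (ord1 j) godel_instance; exact: sP.
pose phi := Falln 5 (Fimp (Fgraph h 6 [tuple 4] 5) (Fzero 6 5)).
have phi_closed : closed_below 5 phi.
  apply: closed_alln; rewrite closed_imp closed_zero // andbT.
  by apply: closed_graph => // j; rewrite (ord1 j).
(* Hides the numeral [godel phi] from conversion. *)
have [m mE] : exists m, m = godel phi by eexists.
pose S := Finstance m phi.
have S_sent : sentence S by exact: sentence_instance.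
have [ThS nThS] := fP S S_sent.
have {}hE z : reval f [tuple godel S] z -> reval h [tuple m] z.
  by rewrite /S mE; exact: hE.
have [/[dup] /ThS /hE h1|/[dup] /nThS /hE h0] := EM (Th S).
- have [K hK] := graph_complete L h1.
  (* Besides the numbers of the computation, [m] and 1 have to exist; both are at most [m.+1]. *)
  have [v [val rv0]] := free_rich free_i (maxn K m.+1) e_inj.
  have [num nums _] := rv0.
  move=> /sound /true_in_instance /(_ v (numbering_strict_order num)).
  have [a ca aE] := nums m (leq_trans (leqnSn m) (leq_maxr _ _)).
  have [b cb bE] := nums 1 (leq_trans (ltn0Sn m) (leq_maxr _ _)).
  have num4 : numbering (update v 4 a) val by exact: numbering_update.
  have num5 : numbering (update (update v 4 a) 5 b) val.
    exact: numbering_update.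
  move=> /(_ a ca); rewrite (sat_numeral _ num4); upd => //.
  move=> /(_ aE); rewrite sat_alln //; upd => /(_ b cb) /=.
  rewrite (sat_zero num5) //; upd => //; rewrite bE => graph0.
  suff /graph0 : satisfies (update (update v 4 a) 5 b) (Fgraph h 6 [tuple 4] 5).
    by [].
  apply: (hK _ val); [|by []|move=> j|].
  + by do 2 (apply: rich_update => //); exact: richW (leq_maxl _ _) rv0.
  + by rewrite (ord1 j) -aE; apply: denotes_update => //; exact: denotes_new.
  + by rewrite -bE; apply: denotes_new => //; upd.
- move=> /(refute _ S_sent)[d' [L' [[X' [i' [_ free_i']]] nS]]].
  apply/nS/true_in_instance => v ord a ca.
  have [s' fin] := free_canonical_joinands_finite free_i' (v 0).
  have [val num] := finite_numbering fin ord.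
  have num4 : numbering (update v 4 a) val by exact: numbering_update.
  rewrite (sat_numeral _ num4); upd => // aE.
  rewrite sat_alln //; upd => b cb /=.
  have num5 : numbering (update (update v 4 a) 5 b) val.
    exact: numbering_update.
  move=> hb; rewrite (sat_zero num5) //; upd => //.
  apply: (reval_functional _ h0); apply: (graph_sound num5 _ _ _ hb) => // j.
  by rewrite (ord1 j) -aE; apply: denotes_update => //; exact: denotes_new.
Qed.

Theorem theorem1p1 :
  undecidable_theory Th_free_lattices /\
  undecidable_theory Th_fg_free_lattices /\
  (forall (X : Type) (d : Order.disp_t) (F : latticeType d) (i : X -> F),
      (exists e : 'I_3 -> X, injective e) ->
      free_lattice_on i ->
      undecidable_theory (Th_lattice F)).
Proof.
(* The free lattice on three generators is the sound model for the first two theories. *)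
have [d [L [i free_i]]] := free_lattice_on_exists 'I_3.
have freeL : free_lattice L by exists 'I_3, i; split=> //; exists; exact: ord0.
have fgL : finitely_generated L.
  exists [seq i x | x <- enum 'I_3] => P Pi PI PU a.
  have [t ->] := free_surj free_i a.
  elim: t => [x|s IHs t IHt|s IHs t IHt] /=.
  - by apply: Pi; apply: map_f; rewrite mem_enum.
  - exact: PI.
  - exact: PU.
(* A sentence outside one of the first two theories fails in some lattice of the class; for the
   third theory [F] itself is both the refuting lattice and the sound model. *)
split; [|split=> [|X d' F j [e e_inj] free_j]]; apply: undecidable_free.
- move=> phi S nTh; apply: contrapT => h; apply: nTh; split=> // d' L' free_L'.
  by apply: contrapT => nt; apply: h; exists d', L'.
- exists d, L, 'I_3, i, id; split=> // phi [_]; exact.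
- move=> phi S nTh; apply: contrapT => h; apply: nTh.
  split=> // d' L' free_L' _.
  by apply: contrapT => nt; apply: h; exists d', L'.
- exists d, L, 'I_3, i, id; split=> // phi [_]; exact.
- move=> phi S nTh; exists d', F; split.
    by exists X, j; split=> //; exists; exact: e ord0.
  by move=> t; apply: nTh.
- by exists d', F, X, j, e; split=> // phi [].
Qed.
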